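(* Let $r>1$ and let $f$ be analytic in (a neighbourhood of) $\overline{G_r}$, where $G_r$ is the interior of the ellipse $E_r$. For each integer $n\ge1$ let $z_k=\cos\frac{k\pi}{n+1}$, $k=1,\dots,n$, let $\omega_n(z)=\prod_{k=1}^n(z-z_k)$, and let $L_{n-1}$ be given by $$L_{n-1}(z)=\frac{1}{2\pi i}\int_{E_r}\frac{\omega_n(t)-\omega_n(z)}{t-z}\,\frac{f(t)}{\omega_n(t)}\,dt,\qquad z\in G_r .$$ Then $$L_{n-1}(z)=\sum_{k=1}^{n}\frac{\omega_n(z)}{z-z_k}\,\frac{f(z_k)}{\omega_n'(z_k)},$$ and $$f(z_k)-L_{n-1}(z_k)=0,\qquad k=1,2,\dots,n .$$ Hence, for $-1\le x\le1$, $$\lim_{n\to\infty}\bigl(f(x)-L_{n-1}(x)\bigr)=0 .$$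
   Context: For $r>1$, $E_r$ is the ellipse $b^2x^2+a^2y^2=a^2b^2$ ($z=x+iy$) with semi-axes $a=\frac12\left(r+\frac1r\right)$, $b=\frac12\left(r-\frac1r\right)$; equivalently $E_r$ is the image of $|w|=r$ under $z=\frac12\left(w+\frac1w\right)$. It is positively oriented as a contour of integration. The points $z_k$ (which depend on $n$) are the roots of the Tchebychev polynomial of the second kind $U_n(z)=\frac{\sin((n+1)\cos^{-1}z)}{\sqrt{1-z^2}}$, so $\omega_n=2^{-n}U_n$. The quotients $\frac{\omega_n(z)}{z-z_k}$ are understood as polynomials in $z$ (also at $z=z_k$). $L_{n-1}$ is the interpolating polynomial, of degree at most $n-1$, corresponding to the interpolation points $z_1,\dots,z_n$. *)

(* Defs.v *)
(* Stdlib reals and Coquelicot; complex numbers are Coquelicot's C. *)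
From Stdlib Require Import Reals Lra List Arith Lia.
From Coquelicot Require Import Coquelicot.
Open Scope R_scope.

Definition semi_a (r : R) : R := (r + / r) / 2.
Definition semi_b (r : R) : R := (r - / r) / 2.

(* The ellipse E_r as a contour: the image of w = r e^{i theta},
   0 <= theta <= 2 pi, under z = (w + 1/w) / 2.  For r > 1 this runs once
   counterclockwise around the origin. *)
Definition ellipse (r theta : R) : C :=
  let w : C := (r * cos theta, r * sin theta) in ((w + / w) / RtoC 2)%C.

Definition ellipse_interior (r : R) (z : C) : Prop :=
  semi_b r ^ 2 * fst z ^ 2 + semi_a r ^ 2 * snd z ^ 2
  < semi_a r ^ 2 * semi_b r ^ 2.

Definition Cclosure (D : C -> Prop) (z : C) : Prop :=
  forall P : C -> Prop, locally z P -> exists w : C, P w /\ D w.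

(* f is only relevant on U: outside U the total function f is arbitrary. *)
Definition analytic_near (D : C -> Prop) (f : C -> C) : Prop :=
  exists U : C -> Prop,
    open U /\ (forall z : C, D z -> U z) /\
    (forall z : C, U z -> @ex_derive C_AbsRing C_NormedModule f z).

Definition path_derive (gamma : R -> C) (t : R) : C :=
  (Derive (fun s => fst (gamma s)) t, Derive (fun s => snd (gamma s)) t).

Definition contour_integral (gamma : R -> C) (s t : R) (g : C -> C) : C :=
  RInt (V := C_R_CompleteNormedModule)
    (fun u => (g (gamma u) * path_derive gamma u)%C) s t.

Definition node (n k : nat) : C := RtoC (cos (INR k * PI / INR (n + 1))).

Definition Cprod (l : list nat) (F : nat -> C) : C :=
  fold_right (fun j p => (F j * p)%C) (RtoC 1) l.

Definition omega (n : nat) (z : C) : C :=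
  Cprod (seq 1 n) (fun j => (z - node n j)%C).

(* The polynomial omega_n(z) / (z - z_k), meaningful also at z = z_k;
   see omega_quotE. *)
Definition omega_quot (n k : nat) (z : C) : C :=
  Cprod (filter (fun j => negb (Nat.eqb j k)) (seq 1 n))
    (fun j => (z - node n j)%C).

(* n is the number of nodes: [interp_poly r f n] is L_{n-1}. *)
Definition interp_poly (r : R) (f : C -> C) (n : nat) (z : C) : C :=
  (/ (RtoC 2 * RtoC PI * Ci) *
   contour_integral (ellipse r) 0 (2 * PI)
     (fun t => (omega n t - omega n z) / (t - z) * (f t / omega n t)))%C.

Lemma ellipseE (r theta : R) : 0 < r ->
  ellipse r theta = (semi_a r * cos theta, semi_b r * sin theta).
Proof.
intros hr. unfold ellipse, semi_a, semi_b.
assert (h : (r * cos theta) ^ 2 + (r * sin theta) ^ 2 = r ^ 2).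
{ replace ((r * cos theta) ^ 2 + (r * sin theta) ^ 2)
    with (r ^ 2 * (Rsqr (sin theta) + Rsqr (cos theta)))
    by (unfold Rsqr; ring).
  rewrite sin2_cos2. ring. }
unfold Cdiv, Cplus, Cmult, Cinv, RtoC; cbn -[pow]. rewrite h.
apply injective_projections; cbn -[pow]; field; lra.
Qed.

Lemma omega_quotE (n k : nat) (z : C) : (1 <= k <= n)%nat ->
  omega n z = ((z - node n k) * omega_quot n k z)%C.
Proof.
intros hk. unfold omega, omega_quot.
assert (hin : In k (seq 1 n)) by (apply in_seq; lia).
generalize (seq_NoDup n 1) hin; generalize (seq 1 n); clear hin hk.
induction l as [|j l IH]; intros hnd hin; [easy|].
inversion hnd as [|? ? hj hl]; subst. simpl.
destruct (Nat.eqb_spec j k) as [->|hjk]; simpl.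
- replace (filter (fun j => negb (Nat.eqb j k)) l) with l; [easy|].
  clear -hj. induction l as [|i l IHl]; [easy|]; simpl in *.
  destruct (Nat.eqb_spec i k); [tauto|]; simpl. f_equal. tauto.
- destruct hin as [hin|hin]; [congruence|].
  rewrite (IH hl hin). ring.
Qed.

(* C_derive is a limit along the real direction only; for omega n it is the
   genuine complex derivative. *)
Lemma is_derive_omega (n : nat) (z : C) :
  @is_derive C_AbsRing C_NormedModule (omega n) z (C_derive (omega n) z).
Proof.
apply C_derive_correct; [exact z|].
enough (h : @ex_derive C_AbsRing (AbsRing_NormedModule C_AbsRing) (omega n) z).
{ destruct h as [d [hl hd]]. exists d. split; [|exact hd].
  destruct hl as [h1 h2 h3]. split; [exact h1|exact h2|exact h3]. }
unfold omega. induction (seq 1 n) as [|j l [d hd]]; simpl.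
- eexists. exact (is_derive_const (K := C_AbsRing)
    (V := AbsRing_NormedModule C_AbsRing) (RtoC 1) z).
- eexists. refine (is_derive_mult (K := C_AbsRing) _ _ z _ _ _ hd Cmult_comm).
  exact (is_derive_minus (K := C_AbsRing) (V := AbsRing_NormedModule C_AbsRing)
    (fun w : C => w) (fun _ => node n j) z _ _
    (is_derive_id (K := C_AbsRing) z)
    (is_derive_const (V := AbsRing_NormedModule C_AbsRing) (node n j) z)).
Qed.

(* Main.v *)
Require Import Defs.
From Stdlib Require Import Reals Lra Lia List Arith IndefiniteDescription.
From Coquelicot Require Import Coquelicot.
Open Scope R_scope.

(** The kernel of the integral defining L_(n-1) is a polynomial in z divided by
    omega_n(t), and its partial fraction expansion in t
    ([kernel_partial_fractions]) is
      sum over k of omega_n(z) / ((z - z_k) omega_n'(z_k)) * 1 / (t - z_k).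
    The integral is therefore a combination of the integrals of
    f(t) / (t - z_k), and Cauchy's formula ([cauchy_ellipse]) turns it into
    Lagrange's interpolation formula.  Evaluating at a node leaves one term,
    equal to f(z_k).

    For the limit, Cauchy's formula at x in [-1, 1] represents the error as
      1/(2 pi i) * integral of omega_n(x) / omega_n(t) * f(t) / (t - x) dt.
    The nodes make omega_n the monic Tchebychev polynomial of the second kind
    ([omega_chebyshev]), so that under t = (w + 1/w)/2
      2^n omega_n(t) = (w^(n+1) - w^(-n-1)) / (w - 1/w)
    ([omega_joukowski], [joukowski_sum_geometric]).  This is at most n + 1 in
    modulus on the segment, where |w| = 1, and grows like r^n on E_r, where
    |w| = r; the quotient tends to 0 uniformly in t ([omega_ratio]).

    Cauchy's formula is established here from complex differentiability alone.
    Goursat's bisection argument ([bisection_zero]) is applied to the form g dz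
    pulled back to a rectangle of parameters, which shows that homotopic closed
    curves have equal integrals ([closed_homotopy_invariance]).  The
    straight-line homotopy between E_r and a small circle about z avoids z
    ([blend_neq]) and stays in the closed ellipse; on the small circle the
    Cauchy integral is close to 2 pi i f(z). *)

Local Notation CInt := (RInt (V := C_R_CompleteNormedModule)).
Local Notation Csum := (sum_n_m (G := C_AbelianMonoid)).

(** Equations produced by the algebraic hierarchy are typed at a structure
    carrier; [ring] and [field] need them at the concrete type. *)
Ltac to_R := match goal with |- @eq _ ?x ?y => change (@eq R x y) end.
Ltac to_C := match goal with |- @eq _ ?x ?y => change (@eq C x y) end.

(** * Curves in the complex plane and their integrals *)

Lemma C_eq (z w : C) : fst z = fst w -> snd z = snd w -> z = w.
Proof. intros h1 h2; destruct z, w; simpl in *; congruence. Qed.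

(** Componentwise, so that continuity of sums and products of complex curves
    reduces to the real theory. *)
Definition curve_cont (p : R -> C) (t : R) : Prop :=
  continuous (fun u => fst (p u)) t /\ continuous (fun u => snd (p u)) t.

Lemma curve_cont_continuous (p : R -> C) (t : R) :
  curve_cont p t -> continuous (U := C_R_CompleteNormedModule) p t.
Proof.
intros [h1 h2]. apply filterlim_locally. intros eps.
assert (k1 := proj1 (filterlim_locally _ _) h1 eps).
assert (k2 := proj1 (filterlim_locally _ _) h2 eps).
generalize (filter_and _ _ k1 k2). apply filter_imp.
intros u hu. exact hu.
Qed.

Lemma Cmod_le_sum (z : C) : Cmod z <= Rabs (fst z) + Rabs (snd z).
Proof.
replace z with ((RtoC (fst z)) + Ci * RtoC (snd z))%C at 1.
- eapply Rle_trans; [apply Cmod_triangle|].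
  rewrite Cmod_mult, Cmod_Ci, !Cmod_R. lra.
- apply C_eq; simpl; ring.
Qed.

Lemma fst_le_Cmod (z : C) : Rabs (fst z) <= Cmod z.
Proof. eapply Rle_trans; [|apply Rmax_Cmod]. apply Rmax_l. Qed.
Lemma snd_le_Cmod (z : C) : Rabs (snd z) <= Cmod z.
Proof. eapply Rle_trans; [|apply Rmax_Cmod]. apply Rmax_r. Qed.

Lemma curve_cont_mod (p : R -> C) (t : R) :
  curve_cont p t <->
  (forall eps, 0 < eps -> locally t (fun u => Cmod (p u - p t) < eps)).
Proof.
split.
- intros [h1 h2] eps he.
  assert (he2 : 0 < eps / 2) by lra.
  assert (k1 := proj1 (filterlim_locally _ _) h1 (mkposreal _ he2)).
  assert (k2 := proj1 (filterlim_locally _ _) h2 (mkposreal _ he2)).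
  generalize (filter_and _ _ k1 k2). apply filter_imp.
  intros u [hu1 hu2].
  change (Rabs (fst (p u) - fst (p t)) < eps / 2) in hu1.
  change (Rabs (snd (p u) - snd (p t)) < eps / 2) in hu2.
  eapply Rle_lt_trans; [apply Cmod_le_sum|]. simpl.
  unfold Rminus in hu1, hu2. lra.
- intros h. split; apply filterlim_locally; intros eps;
  generalize (h eps (cond_pos eps)); apply filter_imp; intros u hu.
  + change (Rabs (fst (p u) - fst (p t)) < eps).
    eapply Rle_lt_trans; [|exact hu]. apply (fst_le_Cmod (p u - p t)%C).
  + change (Rabs (snd (p u) - snd (p t)) < eps).
    eapply Rle_lt_trans; [|exact hu]. apply (snd_le_Cmod (p u - p t)%C).
Qed.

Lemma curve_cont_mult (p q : R -> C) (t : R) :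
  curve_cont p t -> curve_cont q t -> curve_cont (fun u => (p u * q u)%C) t.
Proof.
intros [p1 p2] [q1 q2]. split; simpl.
- apply (continuous_minus (V := R_NormedModule));
  apply (continuous_mult (K := R_AbsRing)); assumption.
- apply (continuous_plus (V := R_NormedModule));
  apply (continuous_mult (K := R_AbsRing)); assumption.
Qed.

Lemma curve_cont_plus (p q : R -> C) (t : R) :
  curve_cont p t -> curve_cont q t -> curve_cont (fun u => (p u + q u)%C) t.
Proof.
intros [p1 p2] [q1 q2]. split; simpl;
apply (continuous_plus (V := R_NormedModule)); assumption.
Qed.

Lemma curve_cont_const (c : C) (t : R) : curve_cont (fun _ => c) t.
Proof. split; apply continuous_const. Qed.

Lemma curve_cont_ext (p q : R -> C) (t : R) :
  (forall u, p u = q u) -> curve_cont p t -> curve_cont q t.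
Proof.
intros e [h1 h2]. split.
- apply (continuous_ext (fun u => fst (p u))); [intros u; now rewrite e|easy].
- apply (continuous_ext (fun u => snd (p u))); [intros u; now rewrite e|easy].
Qed.

Lemma ex_CInt (f : R -> C) (a b : R) :
  (forall t, Rmin a b <= t <= Rmax a b -> curve_cont f t) ->
  ex_RInt (V := C_R_CompleteNormedModule) f a b.
Proof.
intros h. apply ex_RInt_continuous. intros t ht.
apply curve_cont_continuous, h, ht.
Qed.

Definition curve_deriv (p : R -> C) (t : R) (d : C) : Prop :=
  is_derive (fun u => fst (p u)) t (fst d) /\
  is_derive (fun u => snd (p u)) t (snd d).

Lemma curve_deriv_cont (p : R -> C) (t : R) (d : C) :
  curve_deriv p t d -> curve_cont p t.
Proof.
intros [h1 h2]; split; apply (ex_derive_continuous (V := R_NormedModule));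
eexists; eassumption.
Qed.

Lemma is_derive_eq (u : R -> R) (t a b : R) :
  is_derive u t a -> a = b -> is_derive u t b.
Proof. now intros h <-. Qed.

Lemma is_derive_mult_R (u v : R -> R) (t a b : R) :
  is_derive u t a -> is_derive v t b ->
  is_derive (fun x => u x * v x) t (a * v t + u t * b).
Proof.
intros hu hv.
exact (is_derive_mult (K := R_AbsRing) _ _ _ _ _ hu hv Rmult_comm).
Qed.

Lemma curve_deriv_mult (p q : R -> C) (t : R) (dp dq : C) :
  curve_deriv p t dp -> curve_deriv q t dq ->
  curve_deriv (fun u => (p u * q u)%C) t (dp * q t + p t * dq)%C.
Proof.
intros [p1 p2] [q1 q2].
pose proof (is_derive_mult_R _ _ _ _ _ p1 q1).
pose proof (is_derive_mult_R _ _ _ _ _ p2 q2).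
pose proof (is_derive_mult_R _ _ _ _ _ p1 q2).
pose proof (is_derive_mult_R _ _ _ _ _ p2 q1).
split; simpl.
- eapply is_derive_eq;
    [apply (is_derive_minus (V := R_NormedModule)); eassumption|].
  unfold minus, plus, opp; simpl; to_R; ring.
- eapply is_derive_eq;
    [apply (is_derive_plus (V := R_NormedModule)); eassumption|].
  unfold plus; simpl; to_R; ring.
Qed.

Lemma curve_deriv_plus (p q : R -> C) (t : R) (dp dq : C) :
  curve_deriv p t dp -> curve_deriv q t dq ->
  curve_deriv (fun u => (p u + q u)%C) t (dp + dq)%C.
Proof.
intros [p1 p2] [q1 q2]. split; simpl;
apply (is_derive_plus (V := R_NormedModule)); assumption.
Qed.

Lemma curve_deriv_const (c : C) (t : R) : curve_deriv (fun _ => c) t (RtoC 0).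
Proof. split; apply (is_derive_const (V := R_NormedModule)). Qed.

(** Bridge to the vector-valued derivative required by the fundamental
    theorem of calculus, through the decomposition p = Re p * 1 + Im p * i. *)
Lemma curve_deriv_is_derive (p : R -> C) (t : R) (d : C) :
  curve_deriv p t d -> is_derive (V := C_R_CompleteNormedModule) p t d.
Proof.
intros [h1 h2].
pose proof (is_derive_plus (V := C_R_CompleteNormedModule) _ _ _ _ _
 (is_derive_scal_l (V := C_R_CompleteNormedModule) _ _ _ (RtoC 1) h1)
 (is_derive_scal_l (V := C_R_CompleteNormedModule) _ _ _ Ci h2)) as h.
assert (e : forall x y : R, plus (scal (V := C_R_CompleteNormedModule) x (RtoC 1))
    (scal (V := C_R_CompleteNormedModule) y Ci) = ((x, y) : C)).
{ intros x y. apply C_eq; unfold plus, scal; simpl;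
  unfold scal, mult; simpl; unfold plus, mult; simpl; to_R; ring. }
rewrite e in h. replace d with ((fst d, snd d) : C) by now destruct d.
eapply is_derive_ext; [|exact h].
intros u. simpl. rewrite e. now destruct (p u).
Qed.

Lemma CInt_deriv (p dp : R -> C) (a b : R) :
  (forall t, Rmin a b <= t <= Rmax a b -> curve_deriv p t (dp t)) ->
  (forall t, Rmin a b <= t <= Rmax a b -> curve_cont dp t) ->
  CInt dp a b = (p b - p a)%C.
Proof.
intros h1 h2. apply is_RInt_unique.
apply (is_RInt_derive (V := C_R_CompleteNormedModule)).
- intros t ht; apply curve_deriv_is_derive; auto.
- intros t ht; apply curve_cont_continuous; auto.
Qed.

Lemma CInt_bound (f : R -> C) (a b M : R) : a <= b ->
  (forall t, a <= t <= b -> curve_cont f t) ->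
  (forall t, a <= t <= b -> Cmod (f t) <= M) ->
  Cmod (CInt f a b) <= (b - a) * M.
Proof.
intros hab hc hM. rewrite Cmod_norm.
apply (norm_RInt_le_const (V := C_R_CompleteNormedModule) f a b); auto.
- intros t ht. change (Cmod (f t) <= M) || rewrite <- Cmod_norm. auto.
- apply (RInt_correct (V := C_R_CompleteNormedModule)), ex_CInt.
  rewrite Rmin_left, Rmax_right by lra. auto.
Qed.

Lemma CInt_plus (f g : R -> C) (a b : R) :
  (forall t, Rmin a b <= t <= Rmax a b -> curve_cont f t) ->
  (forall t, Rmin a b <= t <= Rmax a b -> curve_cont g t) ->
  CInt (fun t => (f t + g t)%C) a b = (CInt f a b + CInt g a b)%C.
Proof.
intros hf hg. apply (RInt_plus (V := C_R_CompleteNormedModule)); now apply ex_CInt.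
Qed.

Lemma CInt_Chasles (f : R -> C) (a b c : R) : a <= b <= c ->
  (forall t, a <= t <= c -> curve_cont f t) ->
  CInt f a c = (CInt f a b + CInt f b c)%C.
Proof.
intros habc hf. symmetry.
apply (RInt_Chasles (V := C_R_CompleteNormedModule)); apply ex_CInt;
rewrite Rmin_left, Rmax_right by lra; intros; apply hf; lra.
Qed.

Lemma CInt_ext (f g : R -> C) (a b : R) : a <= b ->
  (forall t, a <= t <= b -> f t = g t) -> CInt f a b = CInt g a b.
Proof.
intros hab h. apply (RInt_ext (V := C_R_CompleteNormedModule)).
rewrite Rmin_left, Rmax_right by lra. intros; apply h; lra.
Qed.

(** The scalar is complex while the integral is taken in a real normed
    module, so linearity has to be recovered on the real and imaginary
    parts. *)
Lemma CInt_scal (f : R -> C) (c : C) (a b : R) :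
  (forall t, Rmin a b <= t <= Rmax a b -> curve_cont f t) ->
  CInt (fun t => (c * f t)%C) a b = (c * CInt f a b)%C.
Proof.
intros hf.
assert (ex := ex_CInt f a b hf).
pose proof (RInt_correct (V := C_R_CompleteNormedModule) _ _ _ ex) as h.
apply is_RInt_unique.
pose proof (is_RInt_fct_extend_fst (U := R_NormedModule) (V := R_NormedModule) _ _ _ _ h) as h1.
pose proof (is_RInt_fct_extend_snd (U := R_NormedModule) (V := R_NormedModule) _ _ _ _ h) as h2.
apply (is_RInt_fct_extend_pair (U := R_NormedModule) (V := R_NormedModule)); simpl.
- apply (is_RInt_minus (V := R_NormedModule));
  now apply (is_RInt_scal (V := R_NormedModule)).
- apply (is_RInt_plus (V := R_NormedModule));
  now apply (is_RInt_scal (V := R_NormedModule)).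
Qed.

Lemma CInt_const (c : C) (a b : R) : CInt (fun _ => c) a b = (RtoC (b - a) * c)%C.
Proof.
rewrite <- scal_R_Cmult. apply (RInt_const (V := C_R_CompleteNormedModule)).
Qed.

(** * Goursat's bisection of rectangles *)

Lemma nested_intervals (a b : nat -> R) :
  (forall n, a n <= a (S n)) -> (forall n, b (S n) <= b n) ->
  (forall n, a n <= b n) -> exists l, forall n, a n <= l <= b n.
Proof.
intros ha hb hab.
assert (ma : forall n k, a n <= a (n + k)%nat).
{ intros n k. induction k; [rewrite Nat.add_0_r; lra|].
  rewrite Nat.add_succ_r. specialize (ha (n + k)%nat). lra. }
assert (mb : forall n k, b (n + k)%nat <= b n).
{ intros n k. induction k; [rewrite Nat.add_0_r; lra|].
  rewrite Nat.add_succ_r. specialize (hb (n + k)%nat). lra. }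
assert (hle : forall n m, a n <= b m).
{ intros n m. apply Rle_trans with (a (n + m)%nat); [apply ma|].
  apply Rle_trans with (b (n + m)%nat); [apply hab|].
  rewrite Nat.add_comm. apply mb. }
destruct (completeness (fun x => exists n, x = a n)) as [l [h1 h2]].
- exists (b O). intros x [n ->]. apply hle.
- exists (a O), O. reflexivity.
- exists l. intros n. split.
  + apply h1. now exists n.
  + apply h2. intros x [m ->]. apply hle.
Qed.

Lemma pow2_small (x d : R) : 0 < d -> exists n, x / 2 ^ n < d.
Proof.
intros hd. destruct (Pow_x_infinity 2 ltac:(rewrite Rabs_right; lra) (Rabs x / d + 1)) as [n hn].
exists n. specialize (hn n (le_n n)).
assert (h2 : 0 < 2 ^ n) by (apply pow_lt; lra).
rewrite Rabs_right in hn by lra.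
apply Rmult_lt_reg_r with (2 ^ n); [easy|].
replace (x / 2 ^ n * 2 ^ n) with x by (field; lra).
apply Rle_lt_trans with (Rabs x); [apply Rle_abs|].
apply Rlt_le_trans with (d * (Rabs x / d + 1)).
- replace (d * (Rabs x / d + 1)) with (Rabs x + d) by (field; lra). lra.
- apply Rmult_le_compat_l; lra.
Qed.

Section Bisection.
Variables (J : R -> R -> R -> R -> C) (s0 s1 t0 t1 : R).
Hypotheses (hs : s0 <= s1) (ht : t0 <= t1).
Hypothesis Jadd : forall a b c d, s0 <= a <= b -> b <= s1 -> t0 <= c <= d -> d <= t1 ->
  J a b c d = (J a ((a + b) / 2) c ((c + d) / 2) + J a ((a + b) / 2) ((c + d) / 2) d
    + J ((a + b) / 2) b c ((c + d) / 2) + J ((a + b) / 2) b ((c + d) / 2) d)%C.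
Hypothesis Jloc : forall s t, s0 <= s <= s1 -> t0 <= t <= t1 ->
  forall eps, 0 < eps -> exists del, 0 < del /\ forall a b c d,
    s0 <= a <= s -> s <= b <= s1 -> t0 <= c <= t -> t <= d <= t1 ->
    b - a < del -> d - c < del ->
    Cmod (J a b c d) <= eps * ((b - a) + (d - c)) ^ 2.

Let S0 := s1 - s0.
Let T0 := t1 - t0.
Let K := Cmod (J s0 s1 t0 t1).

Let heavy (n : nat) (p : R * R) : Prop :=
  s0 <= fst p /\ fst p + S0 / 2 ^ n <= s1 /\
  t0 <= snd p /\ snd p + T0 / 2 ^ n <= t1 /\
  K / 4 ^ n <= Cmod (J (fst p) (fst p + S0 / 2 ^ n) (snd p) (snd p + T0 / 2 ^ n)).

Let nested (n : nat) (p q : R * R) : Prop :=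
  fst p <= fst q /\ fst q + S0 / 2 ^ S n <= fst p + S0 / 2 ^ n /\
  snd p <= snd q /\ snd q + T0 / 2 ^ S n <= snd p + T0 / 2 ^ n.

(** If all four quarters of a heavy rectangle were light, the triangle
    inequality applied to the additivity of J would make the rectangle
    itself light. *)
Lemma heavy_step n p : heavy n p -> exists q, heavy (S n) q /\ nested n p q.
Proof.
destruct p as [x y]. unfold heavy, nested; cbn [fst snd]. intros (h1 & h2 & h3 & h4 & h5).
assert (p2 : 0 < 2 ^ n) by (apply pow_lt; lra).
assert (p4 : 0 < 4 ^ n) by (apply pow_lt; lra).
assert (hS : 0 <= S0 / 2 ^ S n).
{ apply Rmult_le_pos; [unfold S0; lra|].
  apply Rlt_le, Rinv_0_lt_compat, pow_lt; lra. }
assert (hT : 0 <= T0 / 2 ^ S n).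
{ apply Rmult_le_pos; [unfold T0; lra|].
  apply Rlt_le, Rinv_0_lt_compat, pow_lt; lra. }
assert (eS : S0 / 2 ^ n = S0 / 2 ^ S n + S0 / 2 ^ S n) by (simpl; field; lra).
assert (eT : T0 / 2 ^ n = T0 / 2 ^ S n + T0 / 2 ^ S n) by (simpl; field; lra).
assert (eK : K / 4 ^ n = 4 * (K / 4 ^ S n)) by (simpl; field; lra).
rewrite Jadd in h5 by lra.
rewrite eS, eT in *. rewrite eK in h5.
set (u := S0 / 2 ^ S n) in *. set (v := T0 / 2 ^ S n) in *.
set (k := K / 4 ^ S n) in *.
replace ((x + (x + (u + u))) / 2) with (x + u) in h5 by field.
replace ((y + (y + (v + v))) / 2) with (y + v) in h5 by field.
replace (x + (u + u)) with (x + u + u) in * by ring.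
replace (y + (v + v)) with (y + v + v) in * by ring.
destruct (Rle_lt_dec k (Cmod (J x (x + u) y (y + v)))) as [c1|c1].
{ exists (x, y). cbn [fst snd]. repeat split; lra. }
destruct (Rle_lt_dec k (Cmod (J x (x + u) (y + v) (y + v + v)))) as [c2|c2].
{ exists (x, y + v). cbn [fst snd]. repeat split; lra. }
destruct (Rle_lt_dec k (Cmod (J (x + u) (x + u + u) y (y + v)))) as [c3|c3].
{ exists (x + u, y). cbn [fst snd]. repeat split; lra. }
destruct (Rle_lt_dec k (Cmod (J (x + u) (x + u + u) (y + v) (y + v + v)))) as [c4|c4].
{ exists (x + u, y + v). cbn [fst snd]. repeat split; lra. }
exfalso.
match type of h5 with _ <= Cmod (?A + ?B + ?D + ?E)%C =>
  pose proof (Cmod_triangle (A + B + D) E);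
  pose proof (Cmod_triangle (A + B) D);
  pose proof (Cmod_triangle A B) end.
lra.
Qed.

(** Goursat's bisection, separated from complex analysis: an additive
    function of rectangles which near every point is negligible compared
    with the squared size of the rectangle vanishes. Otherwise successive
    quarterings give nested rectangles carrying at least the fraction 1/4^n
    of the initial value, while their squared size is also divided by 4^n,
    which contradicts the local bound at their common point. *)
Lemma bisection_zero : J s0 s1 t0 t1 = RtoC 0.
Proof.
apply Cmod_eq_0. fold K.
destruct (Rle_lt_or_eq_dec 0 K (Cmod_ge_0 _)) as [hK|hK]; [exfalso|easy].
assert (b0 : heavy 0 (s0, t0)).
{ unfold heavy; cbn [fst snd pow]. unfold Rdiv. rewrite !Rinv_1, !Rmult_1_r.
  unfold S0, T0.
  replace (s0 + (s1 - s0)) with s1 by ring.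
  replace (t0 + (t1 - t0)) with t1 by ring.
  fold K. lra. }
pose (step := fun n (p : {p | heavy n p}) =>
  constructive_indefinite_description _ (heavy_step n (proj1_sig p) (proj2_sig p))).
pose (sq := fix sq n : {p | heavy n p} := match n with
  | O => exist _ (s0, t0) b0
  | S m => exist _ (proj1_sig (step m (sq m))) (proj1 (proj2_sig (step m (sq m))))
  end).
assert (hn : forall n, nested n (proj1_sig (sq n)) (proj1_sig (sq (S n)))).
{ intros n. exact (proj2 (proj2_sig (step n (sq n)))). }
assert (hb : forall n, heavy n (proj1_sig (sq n))) by (intros n; apply proj2_sig).
assert (p2 : forall n, 0 < 2 ^ n) by (intros; apply pow_lt; lra).
assert (hS : forall n, 0 <= S0 / 2 ^ n).
{ intros n. apply Rmult_le_pos; [unfold S0; lra|].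
  apply Rlt_le, Rinv_0_lt_compat, p2. }
assert (hT : forall n, 0 <= T0 / 2 ^ n).
{ intros n. apply Rmult_le_pos; [unfold T0; lra|].
  apply Rlt_le, Rinv_0_lt_compat, p2. }
set (q := fun n => proj1_sig (sq n)) in *.
destruct (nested_intervals (fun n => fst (q n)) (fun n => fst (q n) + S0 / 2 ^ n))
  as [s hs'].
{ intros n. apply (hn n). } { intros n. apply (hn n). }
{ intros n. specialize (hS n). lra. }
destruct (nested_intervals (fun n => snd (q n)) (fun n => snd (q n) + T0 / 2 ^ n))
  as [t ht'].
{ intros n. apply (hn n). } { intros n. apply (hn n). }
{ intros n. specialize (hT n). lra. }
assert (rs : s0 <= s <= s1).
{ specialize (hs' O). destruct (hb O) as (h1 & h2 & _). unfold q in hs'. lra. }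
assert (rt : t0 <= t <= t1).
{ specialize (ht' O). destruct (hb O) as (_ & _ & h1 & h2 & _). unfold q in ht'. lra. }
set (A := (S0 + T0) ^ 2).
assert (hA : 0 <= A) by apply pow2_ge_0.
destruct (Jloc s t rs rt (K / (2 * (A + 1)))) as [del [hdel hJ]].
{ apply Rdiv_lt_0_compat; lra. }
destruct (pow2_small (S0 + T0) del hdel) as [n hn'].
assert (e1 : (S0 + T0) / 2 ^ n = S0 / 2 ^ n + T0 / 2 ^ n) by (field; apply Rgt_not_eq, p2).
specialize (hS n). specialize (hT n). specialize (hs' n). specialize (ht' n).
destruct (hb n) as (h1 & h2 & h3 & h4 & h5). fold (q n) in h1, h2, h3, h4, h5.
specialize (hJ (fst (q n)) (fst (q n) + S0 / 2 ^ n) (snd (q n)) (snd (q n) + T0 / 2 ^ n)).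
simpl in hs', ht'.
assert (hJ' := fun a b c d e => hJ a b c d e ltac:(lra)). clear hJ.
specialize (hJ' ltac:(lra) ltac:(lra) ltac:(lra) ltac:(lra) ltac:(lra)).
replace (fst (q n) + S0 / 2 ^ n - fst (q n) + (snd (q n) + T0 / 2 ^ n - snd (q n)))
  with ((S0 + T0) / 2 ^ n) in hJ' by (rewrite e1; ring).
assert (p4 : 0 < 4 ^ n) by (apply pow_lt; lra).
assert (e4 : ((S0 + T0) / 2 ^ n) ^ 2 = A / 4 ^ n).
{ replace 4 with (2 ^ 2) by ring. rewrite <- pow_mult, Nat.mul_comm, pow_mult.
  unfold A. specialize (p2 n). field. lra. }
rewrite e4 in hJ'.
assert (hh : K / 4 ^ n <= K / (2 * (A + 1)) * (A / 4 ^ n)) by lra.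
apply (Rmult_le_compat_r (4 ^ n)) in hh; [|lra].
replace (K / 4 ^ n * 4 ^ n) with K in hh by (field; lra).
replace (K / (2 * (A + 1)) * (A / 4 ^ n) * 4 ^ n) with (K * (A / (2 * (A + 1)))) in hh
  by (field; lra).
assert (A / (2 * (A + 1)) < 1).
{ apply Rmult_lt_reg_r with (2 * (A + 1)); [lra|].
  replace (A / (2 * (A + 1)) * (2 * (A + 1))) with A by (field; lra). lra. }
nra.
Qed.
End Bisection.

(** * Holomorphic functions and homotopies of closed curves *)

(** Complex differentiability in terms of the modulus only; no continuity of
    the derivative is required, which is why Goursat's argument is needed. *)
Definition holomorphic_at (g : C -> C) (w : C) : Prop :=
  exists d : C, forall eps, 0 < eps -> exists del, 0 < del /\
    forall v, Cmod (v - w)%C < del ->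
      Cmod (g v - (g w + d * (v - w)))%C <= eps * Cmod (v - w)%C.

Lemma holo_cont g w : holomorphic_at g w -> forall eps, 0 < eps -> exists del, 0 < del /\
  forall v, Cmod (v - w)%C < del -> Cmod (g v - g w)%C < eps.
Proof.
intros [d hd] eps he. destruct (hd 1 Rlt_0_1) as [del [h1 h2]].
pose proof (Cmod_ge_0 d) as h0.
exists (Rmin del (eps / (Cmod d + 2))). split.
- apply Rmin_pos; [easy|]. apply Rdiv_lt_0_compat; lra.
- intros v hv. pose proof (Rmin_l del (eps / (Cmod d + 2))).
  pose proof (Rmin_r del (eps / (Cmod d + 2))).
  specialize (h2 v ltac:(lra)).
  replace (g v - g w)%C with ((g v - (g w + d * (v - w))) + d * (v - w))%C by ring.
  eapply Rle_lt_trans; [apply Cmod_triangle|]. rewrite Cmod_mult.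
  assert (Cmod (v - w) < eps / (Cmod d + 2)) as hx by lra.
  apply (Rmult_lt_compat_r (Cmod d + 2)) in hx; [|lra].
  replace (eps / (Cmod d + 2) * (Cmod d + 2)) with eps in hx by (field; lra).
  pose proof (Cmod_ge_0 (v - w)). nra.
Qed.

Lemma curve_cont_holo g p t : curve_cont p t -> holomorphic_at g (p t) ->
  curve_cont (fun u => g (p u)) t.
Proof.
intros hp hg. apply curve_cont_mod. intros eps he.
destruct (holo_cont _ _ hg eps he) as [del [h1 h2]].
generalize (proj1 (curve_cont_mod p t) hp del h1). apply filter_imp.
intros u hu. now apply h2.
Qed.

(** The integral of the affine part of g has the explicit primitive P, so it
    depends on the endpoints of the path only: around a closed contour these
    terms cancel and only the remainder e is left. *)
Lemma almost_affine_integral (g : C -> C) (p dp : R -> C) (a b : R) (w d : C) (e K : R) :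
  a <= b ->
  (forall u, a <= u <= b -> curve_deriv p u (dp u)) ->
  (forall u, a <= u <= b -> curve_cont dp u) ->
  (forall u, a <= u <= b -> holomorphic_at g (p u)) ->
  (forall u, a <= u <= b -> Cmod (dp u) <= K) ->
  (forall u, a <= u <= b -> Cmod (g (p u) - (g w + d * (p u - w)))%C <= e) ->
  let P v := ((g w - d * w) * v + d * (/ RtoC 2) * (v * v))%C in
  Cmod (CInt (fun u => (g (p u) * dp u)%C) a b - (P (p b) - P (p a)))%C <= (b - a) * (e * K).
Proof.
intros hab h1 h2 h3 hK he P.
assert (c1 : forall u, a <= u <= b -> curve_cont p u)
  by (intros; eapply curve_deriv_cont; eauto).
assert (hP : CInt (fun u => ((g w + d * (p u - w)) * dp u)%C) a b = (P (p b) - P (p a))%C).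
{ apply (CInt_deriv (fun u => P (p u))); rewrite Rmin_left, Rmax_right by lra; intros u hu.
  - unfold P.
    pose proof (curve_deriv_plus _ _ _ _ _
      (curve_deriv_mult _ _ _ _ _ (curve_deriv_const (g w - d * w) u) (h1 u hu))
      (curve_deriv_mult _ _ _ _ _ (curve_deriv_const (d * / RtoC 2) u)
         (curve_deriv_mult _ _ _ _ _ (h1 u hu) (h1 u hu)))) as hh.
    match type of hh with curve_deriv _ _ ?D =>
      replace ((g w + d * (p u - w)) * dp u)%C with D; [exact hh|] end.
    field.
  - apply curve_cont_mult; [|auto]. apply curve_cont_plus; [apply curve_cont_const|].
    apply curve_cont_mult; [apply curve_cont_const|].
    apply curve_cont_plus; [auto|apply curve_cont_const]. }
rewrite <- hP.
assert (cl : forall u, a <= u <= b -> curve_cont (fun u => ((g w + d * (p u - w)) * dp u)%C) u).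
{ intros u hu. apply curve_cont_mult; [|auto]. apply curve_cont_plus; [apply curve_cont_const|].
    apply curve_cont_mult; [apply curve_cont_const|].
    apply curve_cont_plus; [auto|apply curve_cont_const]. }
assert (cg : forall u, a <= u <= b -> curve_cont (fun u => (g (p u) * dp u)%C) u).
{ intros u hu. apply curve_cont_mult; [|auto]. apply (curve_cont_holo g p); auto. }
assert (cr : forall u, a <= u <= b ->
   curve_cont (fun u => ((g (p u) - (g w + d * (p u - w))) * dp u)%C) u).
{ intros u hu. apply curve_cont_mult; [|auto]. apply curve_cont_plus.
  - apply (curve_cont_holo g p); auto.
  - assert (k : curve_cont (fun x => (- RtoC 1) * (g w + d * (p x - w)))%C u).
    { apply curve_cont_mult; [apply curve_cont_const|].
      apply curve_cont_plus; [apply curve_cont_const|].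
      apply curve_cont_mult; [apply curve_cont_const|].
      apply curve_cont_plus; [auto|apply curve_cont_const]. }
    apply curve_cont_mod. intros eps heps. generalize (proj1 (curve_cont_mod _ _) k eps heps).
    apply filter_imp. intros x hx. eapply Rle_lt_trans; [|exact hx]. right. f_equal.
    ring. }
replace (CInt (fun u => (g (p u) * dp u)%C) a b) with
  (CInt (fun u => ((g (p u) - (g w + d * (p u - w))) * dp u)%C) a b
   + CInt (fun u => ((g w + d * (p u - w)) * dp u)%C) a b)%C.
- assert (E : forall X Y : C, (X + Y - Y)%C = X) by (intros; ring). rewrite E.
  apply CInt_bound; auto. intros u hu. rewrite Cmod_mult.
  apply Rmult_le_compat; auto using Cmod_ge_0.
- rewrite <- CInt_plus by (rewrite Rmin_left, Rmax_right by lra; auto).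
  apply CInt_ext; auto. intros; ring.
Qed.

Lemma curve_lipschitz (p dp : R -> C) (lo hi K a b : R) :
  (forall u, curve_deriv p u (dp u)) -> (forall u, curve_cont dp u) ->
  (forall u, lo <= u <= hi -> Cmod (dp u) <= K) ->
  lo <= a <= hi -> lo <= b <= hi ->
  Cmod (p b - p a)%C <= Rabs (b - a) * K.
Proof.
intros h1 h2 hK.
assert (ordered : forall a b, lo <= a -> a <= b -> b <= hi ->
  Cmod (p b - p a)%C <= (b - a) * K).
{ intros a' b' ha hab hb. rewrite <- (CInt_deriv p dp) by auto.
  apply CInt_bound; auto. intros; apply hK; lra. }
intros ha hb. destruct (Rle_lt_dec a b).
- rewrite Rabs_right by lra. apply ordered; lra.
- rewrite Rabs_left by lra. replace (p b - p a)%C with (- (p a - p b))%C by ring.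
  rewrite Cmod_opp. replace (- (b - a)) with (a - b) by ring.
  apply ordered; lra.
Qed.

Section Goursat.
Variables (g : C -> C) (H Hs Ht : R -> R -> C) (s0 s1 t0 t1 K : R).
Hypotheses (hs : s0 <= s1) (ht : t0 <= t1).
Hypothesis dHs : forall s t, curve_deriv (fun x => H x t) s (Hs s t).
Hypothesis dHt : forall s t, curve_deriv (fun x => H s x) t (Ht s t).
Hypothesis cHs : forall s t, curve_cont (fun x => Hs x t) s.
Hypothesis cHt : forall s t, curve_cont (fun x => Ht s x) t.
Hypothesis bHs : forall s t, s0 <= s <= s1 -> t0 <= t <= t1 -> Cmod (Hs s t) <= K.
Hypothesis bHt : forall s t, s0 <= s <= s1 -> t0 <= t <= t1 -> Cmod (Ht s t) <= K.
Hypothesis hg : forall s t, s0 <= s <= s1 -> t0 <= t <= t1 -> holomorphic_at g (H s t).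

Let hor s c d := CInt (fun t => (g (H s t) * Ht s t)%C) c d.
Let ver t a b := CInt (fun s => (g (H s t) * Hs s t)%C) a b.

(** The pullback of g dz by H has zero integral over the boundary of a
    parameter rectangle. Bisecting the rectangle of parameters instead of a
    triangle in the plane gives the homotopy form of Cauchy's theorem
    directly, without constructing a primitive of g. On a small rectangle of
    size L, g differs from its tangent affine map by at most e K L on a
    contour of length at most 2 K L. *)
Theorem goursat_rectangle :
  (ver t0 s0 s1 + hor s1 t0 t1 - ver t1 s0 s1 - hor s0 t0 t1)%C = RtoC 0.
Proof.
assert (chor : forall s t, s0 <= s <= s1 -> t0 <= t <= t1 ->
   curve_cont (fun t => (g (H s t) * Ht s t)%C) t).
{ intros s t h1 h2. apply curve_cont_mult; [|auto].
  apply (curve_cont_holo g (H s)); [eapply curve_deriv_cont; apply dHt|auto]. }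
assert (cver : forall s t, s0 <= s <= s1 -> t0 <= t <= t1 ->
   curve_cont (fun s => (g (H s t) * Hs s t)%C) s).
{ intros s t h1 h2. apply curve_cont_mult; [|auto].
  apply (curve_cont_holo g (fun s => H s t)); [eapply curve_deriv_cont; apply dHs|auto]. }
apply (bisection_zero (fun a b c d => (ver c a b + hor b c d - ver d a b - hor a c d)%C)
  s0 s1 t0 t1); auto.
- intros a b c d ha hb hc hd.
  assert (Eh : forall s, s0 <= s <= s1 -> hor s c d = (hor s c ((c + d) / 2) + hor s ((c + d) / 2) d)%C).
  { intros s hh. apply CInt_Chasles; [lra|]. intros; apply chor; lra. }
  assert (Ev : forall t, t0 <= t <= t1 -> ver t a b = (ver t a ((a + b) / 2) + ver t ((a + b) / 2) b)%C).
  { intros t hh. apply CInt_Chasles; [lra|]. intros; apply cver; lra. }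
  rewrite (Eh a), (Eh b), (Ev c), (Ev d) by lra. ring.
- intros s t h1 h2 eps he.
  assert (hK : 0 <= K).
  { eapply Rle_trans; [apply Cmod_ge_0|apply (bHs s t); auto]. }
  destruct (hg s t h1 h2) as [d hd].
  (* the four sides together give 2 e K^2 L^2, to be at most eps L^2 *)
  set (e := eps / (2 * K * K + 1)).
  assert (hK2 : 0 < 2 * K * K + 1) by nra.
  assert (he' : 0 < e) by (apply Rdiv_lt_0_compat; lra).
  destruct (hd e he') as [del [hdel hloc]].
  exists (del / (2 * K + 1)).
  split; [apply Rdiv_lt_0_compat; lra|].
  intros a b c d' ha hb hc hd' l1 l2.
  assert (hab : b - a + (d' - c) < 2 * (del / (2 * K + 1))) by lra.
  set (L := b - a + (d' - c)) in *.
  assert (hL : 0 <= L) by (unfold L; lra).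
  assert (hLK : K * L < del).
  { replace del with ((2 * (del / (2 * K + 1))) * (K + / 2)) by (field; lra).
    nra. }
  assert (near : forall s' t', a <= s' <= b -> c <= t' <= d' ->
    Cmod (H s' t' - H s t)%C <= K * L).
  { intros s' t' k1 k2.
    replace (H s' t' - H s t)%C with ((H s' t' - H s t') + (H s t' - H s t))%C by ring.
    eapply Rle_trans; [apply Cmod_triangle|].
    pose proof (curve_lipschitz (fun x => H x t') (fun x => Hs x t') s0 s1 K s s'
      ltac:(auto) ltac:(auto) ltac:(intros; apply bHs; lra) ltac:(lra) ltac:(lra)) as q1.
    pose proof (curve_lipschitz (fun x => H s x) (fun x => Ht s x) t0 t1 K t t'
      ltac:(auto) ltac:(auto) ltac:(intros; apply bHt; lra) ltac:(lra) ltac:(lra)) as q2.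
    simpl in q1, q2.
    assert (Rabs (s' - s) <= b - a) by (apply Rabs_le; lra).
    assert (Rabs (t' - t) <= d' - c) by (apply Rabs_le; lra).
    unfold L. nra. }
  assert (near' : forall s' t', a <= s' <= b -> c <= t' <= d' ->
    Cmod (g (H s' t') - (g (H s t) + d * (H s' t' - H s t)))%C <= e * (K * L)).
  { intros s' t' k1 k2. specialize (near s' t' k1 k2).
    eapply Rle_trans; [apply hloc; lra|]. apply Rmult_le_compat_l; lra. }
  pose proof (almost_affine_integral g (fun x => H x c) (fun x => Hs x c) a b (H s t) d
    (e * (K * L)) K ltac:(lra) ltac:(auto) ltac:(auto) ltac:(intros; apply hg; lra)
    ltac:(intros; apply bHs; lra) ltac:(intros; apply near'; lra)) as E1.
  pose proof (almost_affine_integral g (fun x => H x d') (fun x => Hs x d') a b (H s t) d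
    (e * (K * L)) K ltac:(lra) ltac:(auto) ltac:(auto) ltac:(intros; apply hg; lra)
    ltac:(intros; apply bHs; lra) ltac:(intros; apply near'; lra)) as E2.
  pose proof (almost_affine_integral g (fun x => H a x) (fun x => Ht a x) c d' (H s t) d
    (e * (K * L)) K ltac:(lra) ltac:(auto) ltac:(auto) ltac:(intros; apply hg; lra)
    ltac:(intros; apply bHt; lra) ltac:(intros; apply near'; lra)) as E3.
  pose proof (almost_affine_integral g (fun x => H b x) (fun x => Ht b x) c d' (H s t) d
    (e * (K * L)) K ltac:(lra) ltac:(auto) ltac:(auto) ltac:(intros; apply hg; lra)
    ltac:(intros; apply bHt; lra) ltac:(intros; apply near'; lra)) as E4.
  cbv zeta in E1, E2, E3, E4.
  set (P := fun v => ((g (H s t) - d * H s t) * v + d * / 2 * (v * v))%C) in *.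
  change (Cmod (ver c a b - (P (H b c) - P (H a c)))%C <= (b - a) * (e * (K * L) * K)) in E1.
  change (Cmod (ver d' a b - (P (H b d') - P (H a d')))%C <= (b - a) * (e * (K * L) * K)) in E2.
  change (Cmod (hor a c d' - (P (H a d') - P (H a c)))%C <= (d' - c) * (e * (K * L) * K)) in E3.
  change (Cmod (hor b c d' - (P (H b d') - P (H b c)))%C <= (d' - c) * (e * (K * L) * K)) in E4.
  replace (ver c a b + hor b c d' - ver d' a b - hor a c d')%C with
   ((ver c a b - (P (H b c) - P (H a c))) + (hor b c d' - (P (H b d') - P (H b c)))
    + (- (ver d' a b - (P (H b d') - P (H a d')))) + - (hor a c d' - (P (H a d') - P (H a c))))%C
   by ring.
  eapply Rle_trans; [apply Cmod_triangle|]. rewrite Cmod_opp.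
  match goal with |- Cmod (?X + ?Y + ?Z)%C + _ <= _ =>
    pose proof (Cmod_triangle (X + Y) Z) as i1; pose proof (Cmod_triangle X Y) as i2 end.
  rewrite Cmod_opp in i1.
  apply Rle_trans with (2 * (e * K * K) * L ^ 2).
  { assert ((b - a) * (e * (K * L) * K) + (d' - c) * (e * (K * L) * K) = (e * K * K) * L ^ 2)
      by (unfold L; ring). lra. }
  apply Rmult_le_compat_r; [apply pow2_ge_0|].
  replace eps with (e * (2 * K * K + 1)) by (unfold e; field; lra). nra.
Qed.

(** For a homotopy of closed curves the two vertical sides of the parameter
    rectangle have the same image and cancel. *)
Theorem closed_homotopy_invariance :
  (forall s, H s t0 = H s t1) -> (forall s, Hs s t0 = Hs s t1) ->
  hor s0 t0 t1 = hor s1 t0 t1.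
Proof.
intros e1 e2. pose proof goursat_rectangle as G.
replace (ver t1 s0 s1) with (ver t0 s0 s1) in G.
- apply Ceq_minus. rewrite <- Copp_0, <- G. ring.
- apply CInt_ext; auto. intros; now rewrite e1, e2.
Qed.
End Goursat.

(** * Operations on holomorphic functions *)

Lemma ex_derive_holo (f : C -> C) (w : C) :
  @ex_derive C_AbsRing C_NormedModule f w -> holomorphic_at f w.
Proof.
intros [l [_ h]]. exists l. intros eps he.
specialize (h w (fun P k => k) (mkposreal eps he)).
destruct h as [del hd]. exists del. split; [apply cond_pos|].
intros v hv. specialize (hd v hv). simpl in hd.
change (Cmod ((f v - f w) - (v - w) * l)%C <= eps * Cmod (v - w)%C) in hd.
eapply Rle_trans; [|exact hd]. right. f_equal. ring.
Qed.

Lemma holo_mult f g w : holomorphic_at f w -> holomorphic_at g w -> holomorphic_at (fun v => (f v * g v)%C) w.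
Proof.
intros [df hf] hg. assert (cg := holo_cont g w hg). destruct hg as [dg hg].
exists (df * g w + f w * dg)%C. intros eps he.
pose proof (Cmod_ge_0 (g w)) as g0. pose proof (Cmod_ge_0 df) as d0.
pose proof (Cmod_ge_0 (f w)) as f0.
set (M := Cmod (g w) + 1 + Cmod df + Cmod (f w)).
assert (hM : 0 < M) by (unfold M; lra).
assert (he' : 0 < Rmin 1 (eps / M)).
{ apply Rmin_pos; [lra|]. apply Rdiv_lt_0_compat; lra. }
set (e := Rmin 1 (eps / M)) in *.
destruct (hf e he') as [d1 [p1 q1]]. destruct (hg e he') as [d2 [p2 q2]].
destruct (cg e he') as [d3 [p3 q3]].
exists (Rmin d1 (Rmin d2 d3)). split; [repeat apply Rmin_pos; auto|].
intros v hv.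
pose proof (Rmin_l d1 (Rmin d2 d3)). pose proof (Rmin_r d1 (Rmin d2 d3)).
pose proof (Rmin_l d2 d3). pose proof (Rmin_r d2 d3).
specialize (q1 v ltac:(lra)). specialize (q2 v ltac:(lra)). specialize (q3 v ltac:(lra)).
replace (f v * g v - (f w * g w + (df * g w + f w * dg) * (v - w)))%C with
 (g v * (f v - (f w + df * (v - w))) + df * (v - w) * (g v - g w)
  + f w * (g v - (g w + dg * (v - w))))%C by ring.
eapply Rle_trans; [apply Cmod_triangle|].
eapply Rle_trans; [apply Rplus_le_compat_r, Cmod_triangle|].
rewrite !Cmod_mult.
assert (hgv : Cmod (g v) <= Cmod (g w) + 1).
{ replace (g v) with (g w + (g v - g w))%C by ring.
  eapply Rle_trans; [apply Cmod_triangle|]. pose proof (Rmin_l 1 (eps / M)). fold e in H3. lra. }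
set (D := Cmod (v - w)) in *. assert (hD : 0 <= D) by apply Cmod_ge_0.
apply Rle_trans with (M * e * D).
- pose proof (Cmod_ge_0 (g v)).
  assert (Cmod (g v) * Cmod (f v - (f w + df * (v - w))) <= (Cmod (g w) + 1) * (e * D)).
  { apply Rmult_le_compat; auto using Cmod_ge_0. }
  assert (Cmod df * D * Cmod (g v - g w) <= Cmod df * D * e).
  { apply Rmult_le_compat_l; [now apply Rmult_le_pos|lra]. }
  assert (Cmod (f w) * Cmod (g v - (g w + dg * (v - w))) <= Cmod (f w) * (e * D)).
  { apply Rmult_le_compat_l; lra. }
  unfold M. lra.
- apply Rmult_le_compat_r; [easy|].
  apply Rle_trans with (M * (eps / M)); [|right; field; lra].
  apply Rmult_le_compat_l; [lra|]. apply Rmin_r.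
Qed.

Lemma holo_inv_sub (z w : C) : w <> z -> holomorphic_at (fun v => (/ (v - z))%C) w.
Proof.
intros hwz. assert (n : (w - z)%C <> RtoC 0) by now apply Cminus_eq_contra.
exists (- (/ (w - z)) * / (w - z))%C. intros eps he.
assert (p := proj1 (Cmod_gt_0 _) n). set (q := Cmod (w - z)) in *.
assert (hq3 : 0 < eps * q ^ 3 / 2).
{ apply Rdiv_lt_0_compat; [|lra]. apply Rmult_lt_0_compat; [easy|]. now apply pow_lt. }
exists (Rmin (q / 2) (eps * q ^ 3 / 2)). split; [apply Rmin_pos; lra|].
intros v hv. pose proof (Rmin_l (q / 2) (eps * q ^ 3 / 2)).
pose proof (Rmin_r (q / 2) (eps * q ^ 3 / 2)).
assert (hv2 : q / 2 <= Cmod (v - z)).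
{ assert (q <= Cmod (v - z) + Cmod (v - w)); [|lra].
  unfold q. replace (w - z)%C with ((v - z) + - (v - w))%C by ring.
  eapply Rle_trans; [apply Cmod_triangle|]. rewrite Cmod_opp. lra. }
assert (nv : (v - z)%C <> RtoC 0) by (apply Cmod_gt_0; lra).
replace (/ (v - z) - (/ (w - z) + - / (w - z) * / (w - z) * (v - w)))%C with
 ((v - w) * ((v - w) * / (v - z) * / (w - z) * / (w - z)))%C by (field; auto).
rewrite !Cmod_mult, !Cmod_inv by auto. fold q.
rewrite Rmult_comm. apply Rmult_le_compat_r; [apply Cmod_ge_0|].
assert (/ Cmod (v - z) <= 2 / q).
{ replace (2 / q) with (/ (q / 2)) by (field; lra). apply Rinv_le_contravar; lra. }
apply Rle_trans with (eps * q ^ 3 / 2 * (2 / q) * / q * / q); [|right; field; lra].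
repeat apply Rmult_le_compat; try (apply Rlt_le, Rinv_0_lt_compat; lra);
  repeat apply Rmult_le_pos; auto using Cmod_ge_0; try (apply Rlt_le, Rinv_0_lt_compat; lra); lra.
Qed.

(** * Cauchy's integral formula on the ellipse *)

(** Level sets of this quadratic form are the ellipses homothetic to E_r,
    which is its level set a^2 b^2. *)
Definition ellipse_form (r : R) (z : C) : R :=
  semi_b r ^ 2 * fst z ^ 2 + semi_a r ^ 2 * snd z ^ 2.

Lemma semi_pos (r : R) : 1 < r -> 1 < semi_a r /\ 0 < semi_b r.
Proof.
intros h. unfold semi_a, semi_b.
assert (h1 : r * / r = 1) by (field; lra).
assert (h2 : 0 < / r) by (apply Rinv_0_lt_compat; lra).
assert (h3 : / r < 1) by (rewrite <- Rinv_1; apply Rinv_lt_contravar; lra).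
split; [|lra]. nra.
Qed.

(** A point of the closed region is the limit of its contractions towards
    the centre, which are interior. *)
Lemma closed_ellipse_closure (r : R) (z : C) : 1 < r ->
  ellipse_form r z <= semi_a r ^ 2 * semi_b r ^ 2 ->
  Cclosure (ellipse_interior r) z.
Proof.
intros hr hz P [eps hP]. destruct (semi_pos r hr) as [ha hb].
destruct z as [x y].
set (m := Rabs x + Rabs y + 1).
assert (hm : 0 < m) by (unfold m; pose proof (Rabs_pos x); pose proof (Rabs_pos y); lra).
set (d := Rmin (1/2) (eps / (2 * m))).
assert (hd : 0 < d).
{ apply Rmin_pos; [lra|]. apply Rdiv_lt_0_compat; [apply cond_pos|lra]. }
assert (hd1 : d <= 1/2) by apply Rmin_l.
assert (hd2 : d * m <= eps / 2).
{ replace (eps / 2) with (eps / (2 * m) * m) by (field; lra).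
  apply Rmult_le_compat_r; [lra|apply Rmin_r]. }
pose proof (cond_pos eps) as hep.
exists ((1 - d) * x, (1 - d) * y). split.
- apply hP. split.
  + change (Rabs ((1 - d) * x - x) < eps).
    replace ((1 - d) * x - x) with (- (d * x)) by ring.
    rewrite Rabs_Ropp, Rabs_mult, (Rabs_right d) by lra.
    assert (d * Rabs x <= d * m); [|lra]. apply Rmult_le_compat_l; [lra|].
    unfold m. pose proof (Rabs_pos y). lra.
  + change (Rabs ((1 - d) * y - y) < eps).
    replace ((1 - d) * y - y) with (- (d * y)) by ring.
    rewrite Rabs_Ropp, Rabs_mult, (Rabs_right d) by lra.
    assert (d * Rabs y <= d * m); [|lra]. apply Rmult_le_compat_l; [lra|].
    unfold m. pose proof (Rabs_pos x). lra.
- unfold ellipse_interior. unfold ellipse_form in hz. simpl fst in *; simpl snd in *.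
  replace (semi_b r ^ 2 * ((1 - d) * x) ^ 2 + semi_a r ^ 2 * ((1 - d) * y) ^ 2)
   with ((1 - d) ^ 2 * (semi_b r ^ 2 * x ^ 2 + semi_a r ^ 2 * y ^ 2)) by ring.
  assert (0 < semi_a r ^ 2 * semi_b r ^ 2) by (apply Rmult_lt_0_compat; apply pow_lt; lra).
  assert (0 <= (1 - d) ^ 2 < 1) by nra. nra.
Qed.

Lemma analytic_near_holomorphic r f w : 1 < r -> analytic_near (Cclosure (ellipse_interior r)) f ->
  ellipse_form r w <= semi_a r ^ 2 * semi_b r ^ 2 -> holomorphic_at f w.
Proof.
intros hr (U & _ & h1 & h2) hw. apply ex_derive_holo, h2, h1.
now apply closed_ellipse_closure.
Qed.

Definition ellipse_tangent (r t : R) : C := (- semi_a r * sin t, semi_b r * cos t).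

Lemma path_derive_ellipse r t : 1 < r -> path_derive (ellipse r) t = ellipse_tangent r t.
Proof.
intros hr. unfold path_derive, ellipse_tangent.
rewrite (Derive_ext _ (fun s => semi_a r * cos s))
  by (intros; rewrite ellipseE by lra; reflexivity).
rewrite (Derive_ext (fun s => snd (ellipse r s)) (fun s => semi_b r * sin s))
  by (intros; rewrite ellipseE by lra; reflexivity).
f_equal; apply is_derive_unique; auto_derive; auto; ring.
Qed.

Lemma ellipse_neq_interior r t z : 1 < r -> ellipse_interior r z -> ellipse r t <> z.
Proof.
intros hr hz <-. rewrite ellipseE in hz by lra. unfold ellipse_interior in hz; simpl fst in hz; simpl snd in hz.
pose proof (sin2_cos2 t) as e. unfold Rsqr in e.
replace (semi_b r ^ 2 * (semi_a r * cos t) ^ 2 + semi_a r ^ 2 * (semi_b r * sin t) ^ 2)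
  with (semi_a r ^ 2 * semi_b r ^ 2 * (sin t * sin t + cos t * cos t)) in hz by ring.
rewrite e in hz. lra.
Qed.

(** The straight-line homotopy from the circle of radius rho about z (s = 0)
    to the ellipse (s = 1), with its two partial derivatives. *)
Definition blend (r : R) (z : C) (rho s t : R) : C :=
  ((1 - s) * (fst z + rho * cos t) + s * (semi_a r * cos t),
   (1 - s) * (snd z + rho * sin t) + s * (semi_b r * sin t)).
Definition blend_s (r : R) (z : C) (rho s t : R) : C :=
  (semi_a r * cos t - (fst z + rho * cos t), semi_b r * sin t - (snd z + rho * sin t)).
Definition blend_t (r : R) (z : C) (rho s t : R) : C :=
  (- ((1 - s) * rho + s * semi_a r) * sin t, ((1 - s) * rho + s * semi_b r) * cos t).

Lemma small_circle_inside r z : 1 < r -> ellipse_interior r z ->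
  exists rho0, 0 < rho0 /\ forall rho t, 0 < rho <= rho0 ->
  ellipse_form r (fst z + rho * cos t, snd z + rho * sin t) <= semi_a r ^ 2 * semi_b r ^ 2.
Proof.
intros hr hz. destruct (semi_pos r hr) as [ha hb]. unfold ellipse_interior in hz.
destruct z as [x y]. simpl fst in *; simpl snd in *.
set (a := semi_a r) in *. set (b := semi_b r) in *.
set (Q := b ^ 2 * x ^ 2 + a ^ 2 * y ^ 2) in *.
set (M := 2 * b ^ 2 * Rabs x + 2 * a ^ 2 * Rabs y + a ^ 2 + b ^ 2).
pose proof (Rabs_pos x) as ax. pose proof (Rabs_pos y) as ay.
assert (0 < a ^ 2) by (apply pow_lt; lra). assert (0 < b ^ 2) by (apply pow_lt; lra).
assert (hM : 0 < M) by (unfold M; nra).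
exists (Rmin 1 ((a ^ 2 * b ^ 2 - Q) / M)). split.
{ apply Rmin_pos; [lra|]. apply Rdiv_lt_0_compat; lra. }
intros rho t [h0 h1]. unfold ellipse_form; fold a b; simpl fst; simpl snd.
pose proof (Rmin_l 1 ((a ^ 2 * b ^ 2 - Q) / M)).
pose proof (Rmin_r 1 ((a ^ 2 * b ^ 2 - Q) / M)).
assert (h2 : rho * M <= a ^ 2 * b ^ 2 - Q).
{ replace (a ^ 2 * b ^ 2 - Q) with ((a ^ 2 * b ^ 2 - Q) / M * M) by (field; lra).
  apply Rmult_le_compat_r; lra. }
pose proof (COS_bound t) as hc. pose proof (SIN_bound t) as hs.
assert (c1 : x * cos t <= Rabs x).
{ eapply Rle_trans; [apply Rle_abs|]. rewrite Rabs_mult.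
  assert (Rabs (cos t) <= 1) by (apply Rabs_le; lra). nra. }
assert (c2 : y * sin t <= Rabs y).
{ eapply Rle_trans; [apply Rle_abs|]. rewrite Rabs_mult.
  assert (Rabs (sin t) <= 1) by (apply Rabs_le; lra). nra. }
assert (c0 : 0 <= rho * rho <= rho) by nra.
assert (c3 : rho * rho * cos t ^ 2 <= rho) by (assert (0 <= cos t ^ 2 <= 1) by nra; nra).
assert (c4 : rho * rho * sin t ^ 2 <= rho) by (assert (0 <= sin t ^ 2 <= 1) by nra; nra).
assert (b ^ 2 * (x + rho * cos t) ^ 2 + a ^ 2 * (y + rho * sin t) ^ 2
  = Q + 2 * rho * (b ^ 2 * (x * cos t) + a ^ 2 * (y * sin t))
   + b ^ 2 * (rho * rho * cos t ^ 2) + a ^ 2 * (rho * rho * sin t ^ 2)) as -> by (unfold Q; ring).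
assert (b ^ 2 * (x * cos t) + a ^ 2 * (y * sin t) <= b ^ 2 * Rabs x + a ^ 2 * Rabs y) by nra.
unfold M in h2. nra.
Qed.

(** Convexity of the quadratic form. *)
Lemma blend_inside r z rho s t : 1 < r -> 0 <= s <= 1 ->
  ellipse_form r (fst z + rho * cos t, snd z + rho * sin t) <= semi_a r ^ 2 * semi_b r ^ 2 ->
  ellipse_form r (blend r z rho s t) <= semi_a r ^ 2 * semi_b r ^ 2.
Proof.
intros hr hs. unfold ellipse_form, blend; simpl fst; simpl snd.
set (a := semi_a r). set (b := semi_b r).
set (X := fst z + rho * cos t). set (Y := snd z + rho * sin t). intros h.
pose proof (sin2_cos2 t) as e. unfold Rsqr in e.
set (c := cos t) in *. set (d := sin t) in *.
assert (e1 : b ^ 2 * (a * c) ^ 2 + a ^ 2 * (b * d) ^ 2 = a ^ 2 * b ^ 2).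
{ transitivity (a ^ 2 * b ^ 2 * (d * d + c * c)); [ring|]. rewrite e; ring. }
assert (cv : forall u v, ((1 - s) * u + s * v) ^ 2 <= (1 - s) * u ^ 2 + s * v ^ 2).
{ intros u v. assert (0 <= s * (1 - s) * (u - v) ^ 2).
  { apply Rmult_le_pos; [nra|apply pow2_ge_0]. } nra. }
pose proof (cv X (a * c)) as k1. pose proof (cv Y (b * d)) as k2.
apply (Rmult_le_compat_l (b ^ 2)) in k1; [|apply pow2_ge_0].
apply (Rmult_le_compat_l (a ^ 2)) in k2; [|apply pow2_ge_0].
apply Rle_trans with ((1 - s) * (b ^ 2 * X ^ 2 + a ^ 2 * Y ^ 2) +
  s * (b ^ 2 * (a * c) ^ 2 + a ^ 2 * (b * d) ^ 2)); [lra|].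
rewrite e1. nra.
Qed.

(** The outer normal (b cos t, a sin t) of the ellipse at parameter t has
    positive inner product both with the circle point rho e^(it) and, by
    Cauchy-Schwarz since z is interior, with ellipse t - z. Hence no convex
    combination of these two vectors vanishes. *)
Lemma blend_neq r z rho s t : 1 < r -> 0 < rho -> 0 <= s <= 1 -> ellipse_interior r z ->
  blend r z rho s t <> z.
Proof.
intros hr hrho hs hz hb. destruct (semi_pos r hr) as [ha hb'].
unfold ellipse_interior in hz.
apply (f_equal fst) in hb as h1. apply (f_equal snd) in hb as h2.
unfold blend in h1, h2. simpl fst in *; simpl snd in *. clear hb.
set (a := semi_a r) in *. set (b := semi_b r) in *.
set (x := fst z) in *. set (y := snd z) in *.
pose proof (sin2_cos2 t) as e. unfold Rsqr in e.
set (c := cos t) in *. set (d := sin t) in *.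
assert (k0 : b * x * c + a * y * d < a * b).
{ assert ((b * x * c + a * y * d) ^ 2 <= (b ^ 2 * x ^ 2 + a ^ 2 * y ^ 2) * (d * d + c * c)).
  { assert (0 <= (b * x * d - a * y * c) ^ 2) by apply pow2_ge_0. nra. }
  rewrite e in H.
  assert (0 < a * b) by (apply Rmult_lt_0_compat; lra). nra. }
assert (k1 : 0 < b * c * c + a * d * d).
{ destruct (Rlt_le_dec 0 (d * d)); nra. }
assert (k2 : (1 - s) * rho * (b * c * c + a * d * d) + s * (a * b - (b * x * c + a * y * d)) = 0).
{ assert (E1 : (1 - s) * rho * c + s * (a * c - x) = 0) by lra.
  assert (E2 : (1 - s) * rho * d + s * (b * d - y) = 0) by lra.
  (* inner product of the two equations with the normal (b c, a d) *)
  transitivity (b * c * ((1 - s) * rho * c + s * (a * c - x)) +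
    a * d * ((1 - s) * rho * d + s * (b * d - y)) - s * (a * b) * (d * d + c * c - 1)).
  - ring. - rewrite E1, E2, e. ring. }
assert (0 < rho * (b * c * c + a * d * d)) by now apply Rmult_lt_0_compat.
destruct (Rlt_le_dec s (1/2)); nra.
Qed.

Section Cauchy.
Variables (r : R) (f : C -> C) (z : C).
Hypotheses (hr : 1 < r) (hz : ellipse_interior r z).
Hypothesis hf : forall w, ellipse_form r w <= semi_a r ^ 2 * semi_b r ^ 2 -> holomorphic_at f w.

Let circ (rho t : R) : C := (fst z + rho * cos t, snd z + rho * sin t).

(** The Cauchy kernel f w / (w - z) is holomorphic on the image of the
    homotopy [blend]; on the circle dw / (w - z) = i dt. *)
Lemma deform_to_circle (rho : R) : 0 < rho ->
  (forall t, ellipse_form r (circ rho t) <= semi_a r ^ 2 * semi_b r ^ 2) ->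
  CInt (fun t => (f (ellipse r t) * / (ellipse r t - z) * ellipse_tangent r t)%C) 0 (2 * PI)
  = CInt (fun t => (Ci * f (circ rho t))%C) 0 (2 * PI).
Proof.
intros hrho hin. pose proof PI_RGT_0 as hpi. destruct (semi_pos r hr) as [ha hb].
set (K := semi_a r + semi_b r + Rabs (fst z) + Rabs (snd z) + 2 * rho).
pose proof (Rabs_pos (fst z)) as ax. pose proof (Rabs_pos (snd z)) as ay.
assert (bnd : forall m t, 0 <= m -> Rabs (m * cos t) <= m /\ Rabs (m * sin t) <= m).
{ intros m t hm. pose proof (COS_bound t). pose proof (SIN_bound t).
  split; apply Rabs_le; nra. }
pose proof (closed_homotopy_invariance (fun w => (f w * / (w - z))%C)
  (blend r z rho) (blend_s r z rho) (blend_t r z rho) 0 1 0 (2 * PI) K) as G.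
assert (G' : CInt (fun t => (f (blend r z rho 0 t) * / (blend r z rho 0 t - z) * blend_t r z rho 0 t)%C) 0 (2 * PI)
 = CInt (fun t => (f (blend r z rho 1 t) * / (blend r z rho 1 t - z) * blend_t r z rho 1 t)%C) 0 (2 * PI)).
{ apply G; clear G; try lra.
  - intros s t. unfold blend, blend_s; split; simpl; auto_derive; auto; ring.
  - intros s t. unfold blend, blend_t; split; simpl; auto_derive; auto; ring.
  - intros s t. unfold blend_s; split; simpl; apply continuous_const.
  - intros s t. unfold blend_t; split; simpl;
    apply (ex_derive_continuous (V := R_NormedModule)); auto_derive; auto.
  - intros s t hs _. eapply Rle_trans; [apply Cmod_le_sum|]. unfold blend_s; simpl.
    destruct (bnd (semi_a r) t ltac:(lra)) as [B1 _].
    destruct (bnd (semi_b r) t ltac:(lra)) as [_ B2].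
    destruct (bnd rho t ltac:(lra)) as [B3 B4].
    assert (Rabs (semi_a r * cos t - (fst z + rho * cos t)) <= semi_a r + (Rabs (fst z) + rho)).
    { unfold Rminus. eapply Rle_trans; [apply Rabs_triang|]. rewrite Rabs_Ropp.
      pose proof (Rabs_triang (fst z) (rho * cos t)). lra. }
    assert (Rabs (semi_b r * sin t - (snd z + rho * sin t)) <= semi_b r + (Rabs (snd z) + rho)).
    { unfold Rminus. eapply Rle_trans; [apply Rabs_triang|]. rewrite Rabs_Ropp.
      pose proof (Rabs_triang (snd z) (rho * sin t)). lra. }
    unfold K. lra.
  - intros s t hs _. eapply Rle_trans; [apply Cmod_le_sum|]. unfold blend_t; simpl.
    rewrite Ropp_mult_distr_l_reverse, Rabs_Ropp.
    destruct (bnd ((1 - s) * rho + s * semi_a r) t ltac:(nra)) as [_ B1].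
    destruct (bnd ((1 - s) * rho + s * semi_b r) t ltac:(nra)) as [B2 _].
    unfold K. nra.
  - intros s t hs _. apply holo_mult.
    + apply hf, blend_inside; auto. apply hin.
    + apply holo_inv_sub. apply blend_neq; auto.
  - intros s. unfold blend. now rewrite cos_0, sin_0, cos_2PI, sin_2PI.
  - intros s. unfold blend_s. now rewrite cos_0, sin_0, cos_2PI, sin_2PI. }
transitivity (CInt (fun t => (f (blend r z rho 1 t) * / (blend r z rho 1 t - z) * blend_t r z rho 1 t)%C) 0 (2 * PI)).
- apply CInt_ext; [lra|]. intros t _.
  assert (blend r z rho 1 t = ellipse r t) as ->.
  { rewrite ellipseE by lra. unfold blend. apply C_eq; simpl; ring. }
  f_equal. unfold ellipse_tangent, blend_t. apply C_eq; simpl; ring.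
- rewrite <- G'. apply CInt_ext; [lra|]. intros t _.
  assert (E : blend r z rho 0 t = circ rho t).
  { unfold blend, circ. apply C_eq; simpl; ring. }
  rewrite E.
  assert (n : (circ rho t - z)%C <> RtoC 0).
  { rewrite <- E. apply Cminus_eq_contra. apply blend_neq; auto. lra. }
  assert (E2 : blend_t r z rho 0 t = (Ci * (circ rho t - z))%C).
  { unfold blend_t, circ. apply C_eq; simpl; ring. }
  rewrite E2. field. exact n.
Qed.

(** Cauchy's integral formula: the integral does not depend on the radius
    rho of the small circle, and on that circle it tends to 2 pi i f(z) as
    rho tends to 0 because f is continuous at z. *)
Theorem cauchy_ellipse :
  CInt (fun t => (f (ellipse r t) * / (ellipse r t - z) * ellipse_tangent r t)%C) 0 (2 * PI)
  = (RtoC 2 * RtoC PI * Ci * f z)%C.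
Proof.
pose proof PI_RGT_0 as hpi.
destruct (small_circle_inside r z hr hz) as [rho0 [h0 h1]].
match goal with |- ?X = ?Y => enough (D : forall eps, 0 < eps -> Cmod (X - Y)%C <= eps) end.
{ apply Ceq_minus, Cmod_eq_0. apply Rle_antisym; [|apply Cmod_ge_0].
  apply le_epsilon. intros e he. rewrite Rplus_0_l. now apply D. }
intros eps he.
assert (hz' : holomorphic_at f z).
{ apply hf. apply Rlt_le. exact hz. }
destruct (holo_cont f z hz' (eps / (2 * PI)) ltac:(apply Rdiv_lt_0_compat; lra)) as [del [hd hc]].
(* half of del, because continuity is available for distances < del only *)
set (rho := Rmin rho0 (del / 2)).
assert (hrho : 0 < rho) by (apply Rmin_pos; lra).
assert (hrho0 : rho <= rho0) by apply Rmin_l.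
assert (hrd : rho <= del / 2) by apply Rmin_r.
rewrite (deform_to_circle rho) by (auto; intros; apply h1; lra).
assert (cc : forall t, curve_cont (circ rho) t).
{ intros t. split; unfold circ; simpl;
  apply (ex_derive_continuous (V := R_NormedModule)); auto_derive; auto. }
assert (cf : forall t, curve_cont (fun t => (Ci * f (circ rho t))%C) t).
{ intros t. apply curve_cont_mult; [apply curve_cont_const|].
  apply (curve_cont_holo f (circ rho)); auto. apply hf, h1. lra. }
assert (E : (- (RtoC 2 * RtoC PI * Ci * f z))%C = CInt (fun t => (- (Ci * f z))%C) 0 (2 * PI)).
{ rewrite CInt_const, Rminus_0_r, RtoC_mult. ring. }
unfold Cminus. rewrite E, <- CInt_plus by (intros; auto using curve_cont_const).
replace eps with ((2 * PI - 0) * (eps / (2 * PI))) by (field; lra).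
apply CInt_bound; [lra| |].
- intros; apply curve_cont_plus; auto using curve_cont_const.
- intros t _.
  replace (Ci * f (circ rho t) + - (Ci * f z))%C with (Ci * (f (circ rho t) - f z))%C by ring.
  rewrite Cmod_mult, Cmod_Ci, Rmult_1_l. apply Rlt_le, hc.
  assert (circ rho t - z = RtoC rho * (cos t, sin t))%C as ->.
  { unfold circ; apply C_eq; simpl; ring. }
  rewrite Cmod_mult, Cmod_R, Rabs_right by lra.
  assert (Cmod (cos t, sin t) = 1) as ->; [|lra].
  unfold Cmod; simpl fst; simpl snd. transitivity (sqrt 1); [f_equal|apply sqrt_1].
  pose proof (sin2_cos2 t) as e. unfold Rsqr in e. lra.
Qed.
End Cauchy.

(** * Polynomial functions and their roots *)

(** Polynomial functions of degree < n, encoded by iterated division by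
    linear factors: this makes the bound on the number of roots an immediate
    induction and avoids manipulating coefficients. *)
Fixpoint lowdeg (n : nat) (F : C -> C) : Prop :=
  match n with
  | O => forall z, F z = RtoC 0
  | S m => forall w, exists q, lowdeg m q /\ forall z, F z = (F w + (z - w) * q z)%C
  end.

Lemma lowdeg_ext n F G : (forall z, F z = G z) -> lowdeg n F -> lowdeg n G.
Proof.
destruct n; simpl; intros e h.
- intros z. now rewrite <- e.
- intros w. destruct (h w) as [q [h1 h2]]. exists q. split; [easy|].
  intros z. now rewrite <- !e.
Qed.

Lemma lowdeg_lin n : forall F G c, lowdeg n F -> lowdeg n G ->
  lowdeg n (fun z => (F z + c * G z)%C).
Proof.
induction n as [|n IH]; simpl; intros F G c hF hG.
- intros z. rewrite hF, hG. ring.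
- intros w. destruct (hF w) as [p [p1 p2]]. destruct (hG w) as [q [q1 q2]].
  exists (fun z => (p z + c * q z)%C). split; [now apply IH|].
  intros z. rewrite (p2 z), (q2 z). ring.
Qed.

Lemma lowdeg_0 n : lowdeg n (fun _ => RtoC 0).
Proof.
induction n; simpl; [easy|]. intros w. exists (fun _ => RtoC 0). split; [easy|].
intros; ring.
Qed.

Lemma lowdeg_S n : forall F, lowdeg n F -> lowdeg (S n) F.
Proof.
induction n as [|n IH]; intros F h.
- intros w. exists (fun _ => RtoC 0). split; [now intros z|].
  intros z. rewrite !(h _). ring.
- intros w. destruct (h w) as [q [h1 h2]]. exists q. split; [now apply IH|easy].
Qed.

Lemma lowdeg_mul_sub n F a : lowdeg n F -> lowdeg (S n) (fun z => ((z - a) * F z)%C).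
Proof.
destruct n as [|n]; intros h w.
- exists (fun _ => RtoC 0). split; [now intros z|]. intros z. rewrite !(h _). ring.
- destruct (h w) as [q [h1 h2]].
  exists (fun z => (F z + (w - a) * q z)%C). split.
  + apply lowdeg_lin; [easy|]. now apply lowdeg_S.
  + intros z. transitivity ((z - w) * F z + (w - a) * F z)%C; [ring|].
    rewrite (h2 z) at 2. ring.
Qed.

Lemma lowdeg_const n c : lowdeg (S n) (fun _ => c).
Proof. intros w. exists (fun _ => RtoC 0). split; [apply lowdeg_0|]. intros; ring. Qed.

Lemma lowdeg_roots (l : list C) : forall F, NoDup l -> lowdeg (length l) F ->
  (forall a, In a l -> F a = RtoC 0) -> forall z, F z = RtoC 0.
Proof.
induction l as [|a l IH]; intros F hl hF h0; [exact hF|].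
inversion hl as [|? ? hal hl']; subst.
destruct (hF a) as [q [h1 h2]].
assert (hq : forall z, q z = RtoC 0).
{ apply IH; auto. intros b hb.
  specialize (h2 b). rewrite !h0, Cplus_0_l in h2 by (simpl; auto).
  assert (n : (b - a)%C <> RtoC 0) by (apply Cminus_eq_contra; congruence).
  rewrite <- (Cmult_1_l (q b)), <- (Cinv_l (b - a)) by easy.
  rewrite <- Cmult_assoc, <- h2. ring. }
intros z. rewrite (h2 z), hq, h0 by (simpl; auto). ring.
Qed.

Definition monic (n : nat) (F : C -> C) : Prop :=
  exists G, lowdeg n G /\ forall z, F z = (z ^ n + G z)%C.

Lemma monic_lowdeg n F : monic n F -> lowdeg (S n) F.
Proof.
intros [G [h1 h2]]. apply lowdeg_ext with (fun z => (z ^ n + RtoC 1 * G z)%C).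
{ intros z. rewrite h2. ring. }
apply lowdeg_lin; [|now apply lowdeg_S]. clear.
induction n as [|n IH]; [exact (lowdeg_const 0 (RtoC 1))|].
apply lowdeg_ext with (fun z => ((z - RtoC 0) * z ^ n)%C).
- intros z. rewrite Cpow_S. ring.
- now apply lowdeg_mul_sub.
Qed.

Lemma monic_mul_sub n F a : monic n F -> monic (S n) (fun z => ((z - a) * F z)%C).
Proof.
intros h. assert (hl := monic_lowdeg n F h). destruct h as [G [h1 h2]].
exists (fun z => ((z - RtoC 0) * G z + (- a) * F z)%C). split.
- apply lowdeg_lin; [now apply lowdeg_mul_sub|easy].
- intros z. rewrite Cpow_S, h2. ring.
Qed.

Lemma monic_plus_lowdeg n F G : monic n F -> lowdeg n G -> monic n (fun z => (F z + G z)%C).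
Proof.
intros [F1 [h1 h2]] hG. exists (fun z => (F1 z + RtoC 1 * G z)%C). split.
- now apply lowdeg_lin.
- intros z. rewrite h2. ring.
Qed.

(** The difference of two monic polynomials of degree n has degree < n, so
    it is zero once it has n roots. *)
Lemma monic_eq (l : list C) F G : NoDup l -> monic (length l) F -> monic (length l) G ->
  (forall a, In a l -> F a = G a) -> forall z, F z = G z.
Proof.
intros hl [F1 [f1 f2]] [G1 [g1 g2]] h z. apply Ceq_minus.
apply (lowdeg_roots l (fun z => (F z - G z)%C)); auto.
- apply lowdeg_ext with (fun z => (F1 z + - RtoC 1 * G1 z)%C).
  + intros y. rewrite f2, g2. ring.
  + now apply lowdeg_lin.
- intros a ha. exact (proj1 (Ceq_minus _ _) (h a ha)).
Qed.

Lemma monic_Cprod (a : nat -> C) (l : list nat) :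
  monic (length l) (fun z => Cprod l (fun j => (z - a j)%C)).
Proof.
induction l as [|j l IH]; simpl.
- exists (fun _ => RtoC 0). split; [easy|]. intros; simpl; ring.
- now apply (monic_mul_sub _ (fun z => Cprod l (fun j => (z - a j)%C))).
Qed.

Lemma Cprod_zero (F : nat -> C) l k : In k l -> F k = RtoC 0 -> Cprod l F = RtoC 0.
Proof.
induction l as [|j l IH]; simpl; [easy|]. intros [->|h] h0.
- rewrite h0. ring.
- rewrite IH by auto. ring.
Qed.

Lemma Cprod_neq0 (F : nat -> C) l : (forall k, In k l -> F k <> RtoC 0) -> Cprod l F <> RtoC 0.
Proof.
induction l as [|j l IH]; simpl; intros h; [apply C1_nz|].
apply Cmult_neq_0; auto.
Qed.

Lemma holo_Cprod (a : nat -> C) (l : list nat) w : holomorphic_at (fun z => Cprod l (fun j => (z - a j)%C)) w.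
Proof.
induction l as [|j l IH]; simpl.
- exists (RtoC 0). intros eps he. exists 1. split; [lra|]. intros v _.
  replace (1 - (1 + 0 * (v - w)))%C with (RtoC 0) by ring.
  rewrite Cmod_0. apply Rmult_le_pos; [lra|apply Cmod_ge_0].
- apply (holo_mult (fun z => (z - a j)%C)); [|exact IH].
  exists (RtoC 1). intros eps he. exists 1. split; [lra|]. intros v _.
  replace (v - a j - (w - a j + 1 * (v - w)))%C with (RtoC 0) by ring.
  rewrite Cmod_0. apply Rmult_le_pos; [lra|apply Cmod_ge_0].
Qed.

(** * Lagrange interpolation at the nodes *)

Lemma node_angle n k : (k <= n)%nat -> 0 <= INR k * PI / INR (n + 1) < PI.
Proof.
intros h. pose proof PI_RGT_0.
assert (0 < INR (n + 1)) by (apply lt_0_INR; lia).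
assert (INR k < INR (n + 1)) by (apply lt_INR; lia).
pose proof (pos_INR k). split.
- apply Rmult_le_pos; [nra|]. apply Rlt_le, Rinv_0_lt_compat; lra.
- apply Rmult_lt_reg_r with (INR (n + 1)); [easy|].
  replace (INR k * PI / INR (n + 1) * INR (n + 1)) with (INR k * PI) by (field; lra). nra.
Qed.

Lemma node_inj n i j : (i <= n)%nat -> (j <= n)%nat -> node n i = node n j -> i = j.
Proof.
intros hi hj h. apply RtoC_inj in h.
pose proof (node_angle n i hi). pose proof (node_angle n j hj).
apply cos_inj in h; [|lra|lra].
pose proof PI_RGT_0.
assert (0 < INR (n + 1)) by (apply lt_0_INR; lia).
apply INR_eq. apply Rmult_eq_reg_r with (PI / INR (n + 1)).
- unfold Rdiv in *. lra.
- apply Rgt_not_eq, Rdiv_lt_0_compat; lra.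
Qed.

Definition nodes (n : nat) : list C := map (node n) (seq 1 n).

Lemma nodes_NoDup n : NoDup (nodes n).
Proof.
unfold nodes. assert (H : forall l, (forall k, In k l -> (k <= n)%nat) -> NoDup l -> NoDup (map (node n) l)).
{ induction l as [|j l IH]; simpl; intros hb hl; [constructor|].
  inversion hl; subst. constructor; [|apply IH; auto].
  intros hin. apply in_map_iff in hin. destruct hin as [i [e hi]].
  apply node_inj in e; auto. congruence. }
apply H; [|apply seq_NoDup]. intros k hk. apply in_seq in hk. lia.
Qed.

Lemma nodes_length n : length (nodes n) = n.
Proof. unfold nodes. now rewrite length_map, length_seq. Qed.

Lemma in_nodes n a : In a (nodes n) -> exists k, (1 <= k <= n)%nat /\ a = node n k.
Proof.
unfold nodes. rewrite in_map_iff. intros [k [e hk]]. apply in_seq in hk.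
exists k. split; [lia|easy].
Qed.

Lemma omega_node n k : (1 <= k <= n)%nat -> omega n (node n k) = RtoC 0.
Proof.
intros h. unfold omega. apply Cprod_zero with k; [apply in_seq; lia|]. ring.
Qed.

Lemma monic_omega n : monic n (omega n).
Proof. rewrite <- (length_seq n 1) at 1. apply (monic_Cprod (node n)). Qed.

Lemma omega_quot_other n k j : (1 <= j <= n)%nat -> j <> k -> omega_quot n k (node n j) = RtoC 0.
Proof.
intros h hjk. unfold omega_quot. apply Cprod_zero with j; [|ring].
apply filter_In. split; [apply in_seq; lia|]. now apply Bool.negb_true_iff, Nat.eqb_neq.
Qed.

Lemma omega_quot_self n k : (1 <= k <= n)%nat -> omega_quot n k (node n k) <> RtoC 0.
Proof.
intros h. unfold omega_quot. apply Cprod_neq0. intros j hj.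
apply filter_In in hj. destruct hj as [h1 h2]. apply in_seq in h1.
apply Bool.negb_true_iff, Nat.eqb_neq in h2.
apply Cminus_eq_contra. intros e. apply node_inj in e; lia.
Qed.

Lemma lowdeg_omega_quot n k : (1 <= k <= n)%nat -> lowdeg n (omega_quot n k).
Proof.
intros hk.
assert (E : S (length (filter (fun j => negb (Nat.eqb j k)) (seq 1 n))) = n).
{ assert (G : forall l, NoDup l -> In k l -> S (length (filter (fun j => negb (Nat.eqb j k)) l)) = length l).
  { induction l as [|j l IH]; simpl; [easy|]. intros hl [->|h].
    - rewrite Nat.eqb_refl. simpl. f_equal. inversion hl as [|? ? h1 h2]; subst. clear -h1.
      induction l as [|i l IHl]; simpl in *; [easy|].
      destruct (Nat.eqb_spec i k); [tauto|]. simpl. f_equal. tauto.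
    - inversion hl as [|? ? h1 h2]; subst. destruct (Nat.eqb_spec j k); [congruence|].
      simpl. f_equal. now apply IH. }
  rewrite G; [apply length_seq|apply seq_NoDup|apply in_seq; lia]. }
rewrite <- E at 1. apply monic_lowdeg. apply (monic_Cprod (node n)).
Qed.

(** The derivative of (v - z_k) q(v) at z_k is q(z_k) as soon as q is
    continuous there. *)
Lemma C_derive_omega_node n k : (1 <= k <= n)%nat ->
  C_derive (omega n) (node n k) = omega_quot n k (node n k).
Proof.
intros hk. apply is_C_derive_unique.
split; [apply is_linear_scal_l|].
intros x hx eps.
assert (x = node n k) as ->.
{ symmetry. exact (is_filter_lim_locally_unique (V := AbsRing_NormedModule C_AbsRing) _ _ hx). }
destruct (holo_cont _ _ (holo_Cprod (node n) (filter (fun j => negb (Nat.eqb j k)) (seq 1 n)) (node n k))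
   eps (cond_pos eps)) as [del [h1 h2]].
exists (mkposreal del h1). intros v hv. specialize (h2 v hv).
change (Cmod ((omega n v - omega n (node n k)) - (v - node n k) * omega_quot n k (node n k))%C
  <= eps * Cmod (v - node n k)%C).
rewrite omega_node by easy. rewrite (omega_quotE n k v hk).
replace ((v - node n k) * omega_quot n k v - 0 - (v - node n k) * omega_quot n k (node n k))%C
 with ((omega_quot n k v - omega_quot n k (node n k)) * (v - node n k))%C by ring.
rewrite Cmod_mult. apply Rmult_le_compat_r; [apply Cmod_ge_0|]. apply Rlt_le. exact h2.
Qed.

Lemma lowdeg_Csum d (F : nat -> C -> C) a b :
  (forall k, (a <= k <= b)%nat -> lowdeg d (F k)) -> lowdeg d (fun z => Csum (fun k => F k z) a b).
Proof.
intros h. destruct (le_lt_dec a b) as [hab|hab].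
- induction b as [|b IH].
  + assert (a = O) by lia; subst. apply lowdeg_ext with (F O); [|apply h; lia].
    intros z. now rewrite sum_n_n.
  + destruct (Nat.eq_dec a (S b)) as [->|ne].
    * apply lowdeg_ext with (F (S b)); [|apply h; lia]. intros z. now rewrite sum_n_n.
    * apply lowdeg_ext with (fun z => (Csum (fun k => F k z) a b + RtoC 1 * F (S b) z)%C).
      -- intros z. rewrite sum_n_Sm by lia. rewrite Cmult_1_l. reflexivity.
      -- apply lowdeg_lin; [apply IH; [|lia]; intros; apply h; lia|apply h; lia].
- apply lowdeg_ext with (fun _ => RtoC 0); [|apply lowdeg_0].
  intros z. now rewrite sum_n_m_zero.
Qed.

Lemma Csum_single (u : nat -> C) j a b : (a <= j <= b)%nat ->
  (forall k, (a <= k <= b)%nat -> k <> j -> u k = RtoC 0) -> Csum u a b = u j.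
Proof.
intros hj h.
rewrite (sum_n_m_ext_loc _ (fun k => if Nat.eq_dec k j then u j else RtoC 0)).
2:{ intros k hk. destruct (Nat.eq_dec k j); [now subst|auto]. }
clear h. destruct hj as [h1 h2]. induction h2 as [|b hb IH].
- assert (Z : forall m, (m < j)%nat -> Csum (fun k => if Nat.eq_dec k j then u j else RtoC 0) a m = RtoC 0).
  { intros m hm. rewrite (sum_n_m_ext_loc _ (fun _ => zero)).
    - exact (sum_n_m_const_zero (G := C_AbelianMonoid) a m).
    - intros k hk. destruct (Nat.eq_dec k j); [lia|reflexivity]. }
  destruct (Nat.eq_dec a j) as [->|ne].
  + rewrite sum_n_n. destruct (Nat.eq_dec j j); easy.
  + destruct j as [|j]; [lia|]. rewrite sum_n_Sm by lia. rewrite Z by lia.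
    destruct (Nat.eq_dec (S j) (S j)); [|easy]. exact (Cplus_0_l _).
- rewrite sum_n_Sm by lia. rewrite IH. destruct (Nat.eq_dec (S b) j); [lia|].
  exact (Cplus_0_r _).
Qed.

Lemma Csum_scal (c : C) (u : nat -> C) a b : Csum (fun k => (c * u k)%C) a b = (c * Csum u a b)%C.
Proof.
destruct (le_lt_dec a b) as [hab|hab].
- induction hab as [|b hab IH]; [now rewrite !sum_n_n|].
  rewrite !sum_n_Sm by lia. rewrite IH.
  change (c * Csum u a b + c * u (S b) = c * (Csum u a b + u (S b)))%C. ring.
- rewrite !sum_n_m_zero by lia. change (RtoC 0 = c * RtoC 0)%C. ring.
Qed.

(** Lagrange interpolation reproduces constants: the left-hand side minus 1
    has degree < n and vanishes at the n nodes. *)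
Lemma lagrange_unity n z : (1 <= n)%nat ->
  Csum (fun k => (omega_quot n k z / C_derive (omega n) (node n k))%C) 1 n = RtoC 1.
Proof.
intros hn. apply Ceq_minus.
apply (lowdeg_roots (nodes n) (fun z =>
  (Csum (fun k => (omega_quot n k z / C_derive (omega n) (node n k))%C) 1 n - 1)%C)).
- apply nodes_NoDup.
- rewrite nodes_length.
  apply lowdeg_ext with (fun z =>
   (Csum (fun k => (omega_quot n k z / C_derive (omega n) (node n k))%C) 1 n + RtoC 1 * - RtoC 1)%C).
  { intros y. unfold Cminus. now rewrite Cmult_1_l. }
  apply (lowdeg_lin n _ (fun _ => (- RtoC 1)%C)).
  + apply (lowdeg_Csum n (fun k z => (omega_quot n k z / C_derive (omega n) (node n k))%C)).
    intros k hk. apply lowdeg_ext with (fun z => (RtoC 0 + / C_derive (omega n) (node n k) * omega_quot n k z)%C).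
    * intros y. unfold Cdiv. ring.
    * apply lowdeg_lin; [apply lowdeg_0|now apply lowdeg_omega_quot].
  + destruct n; [lia|]. apply lowdeg_const.
- intros a ha. apply in_nodes in ha. destruct ha as [j [hj ->]].
  rewrite (Csum_single _ j) by (auto; intros k hk hkj;
    rewrite omega_quot_other by auto; unfold Cdiv; ring).
  rewrite C_derive_omega_node by easy. field. now apply omega_quot_self.
Qed.

(** Lagrange's identity at t, divided by omega_n(t), is the partial fraction
    expansion of 1/omega_n(t); writing (t - z)/(t - z_k) = 1 - (z - z_k)/(t
    - z_k) and using the identity at z gives the expansion of the whole
    kernel. Thus the integral defining L_(n-1) splits into Cauchy integrals
    at the nodes. *)
Lemma kernel_partial_fractions n z t : (1 <= n)%nat -> t <> z ->
  (forall k, (1 <= k <= n)%nat -> t <> node n k) ->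
  ((omega n t - omega n z) / (t - z) / omega n t)%C =
  Csum (fun k => (omega_quot n k z / C_derive (omega n) (node n k) * / (t - node n k))%C) 1 n.
Proof.
intros hn htz ht.
assert (n1 : (t - z)%C <> RtoC 0) by now apply Cminus_eq_contra.
assert (n2 : omega n t <> RtoC 0).
{ apply Cprod_neq0. intros k hk. apply in_seq in hk. apply Cminus_eq_contra, ht. lia. }
set (c := fun k => (omega_quot n k z / C_derive (omega n) (node n k))%C).
assert (Ht : Csum (fun k => (omega n t * (/ C_derive (omega n) (node n k) * / (t - node n k)))%C) 1 n = RtoC 1).
{ rewrite <- (lagrange_unity n t hn). apply sum_n_m_ext_loc. intros k hk.
  rewrite (omega_quotE n k t hk). unfold Cdiv.
  assert ((t - node n k)%C <> RtoC 0) by (apply Cminus_eq_contra; auto).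
  assert (C_derive (omega n) (node n k) <> RtoC 0)
    by (rewrite C_derive_omega_node by easy; now apply omega_quot_self).
  to_C. field. auto. }
assert (Hz := lagrange_unity n z hn). fold c in Hz.
rewrite Csum_scal in Ht.
set (s := Csum (fun k => (/ C_derive (omega n) (node n k) * / (t - node n k))%C) 1 n) in *.
assert (E : ((t - z) * Csum (fun k => (c k * / (t - node n k))%C) 1 n = RtoC 1 - omega n z * s)%C).
{ rewrite <- Hz. unfold s. rewrite <- !Csum_scal.
  assert (D : forall u v : nat -> C, Csum (fun k => (u k - v k)%C) 1 n = (Csum u 1 n - Csum v 1 n)%C).
  { intros u v. unfold Cminus at 2.
    replace (- Csum v 1 n)%C with (Csum (fun k => (- RtoC 1 * v k)%C) 1 n) by (rewrite Csum_scal; to_C; ring).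
    rewrite <- (sum_n_m_plus (G := C_AbelianMonoid) u). apply sum_n_m_ext. intros k.
    change (u k - v k = u k + - RtoC 1 * v k)%C. to_C. ring. }
  rewrite <- D. apply sum_n_m_ext_loc. intros k hk.
  rewrite (omega_quotE n k z hk). unfold c.
  assert ((t - node n k)%C <> RtoC 0) by (apply Cminus_eq_contra; auto).
  assert (C_derive (omega n) (node n k) <> RtoC 0)
    by (rewrite C_derive_omega_node by easy; now apply omega_quot_self).
  to_C. field. auto. }
assert (alg : forall d o b u X : C, d <> RtoC 0 -> o <> RtoC 0 -> (o * u = RtoC 1)%C ->
  (d * X = RtoC 1 - b * u)%C -> ((o - b) / d / o = X)%C).
{ intros d o b u X hd ho hu hX.
  transitivity ((o * u - b * u) / d)%C.
  - assert (u = / o)%C as ->; [|field; auto].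
    transitivity (/ o * (o * u))%C; [field; auto|]. rewrite hu. ring.
  - rewrite hu, <- hX. field. auto. }
exact (alg _ _ _ _ _ n1 n2 Ht E).
Qed.

(** * Tchebychev polynomials and the Joukowski map *)

(** The sum of w^(n - 2j) for 0 <= j <= n, i.e. U_n at (w + 1/w)/2, for w <>
    0. *)
Fixpoint joukowski_sum (w : C) (n : nat) : C :=
  match n with
  | O => RtoC 1
  | S m => (w * joukowski_sum w m + (/ w) ^ n)%C
  end.

(** With w = e^(i x) this is the formula sin((n+1) x) / sin x for U_n(cos
    x). *)
Lemma joukowski_sum_geometric w n : w <> RtoC 0 ->
  ((w - / w) * joukowski_sum w n = w ^ S n - (/ w) ^ S n)%C.
Proof.
intros hw. induction n as [|n IH]; [simpl; ring|].
change (joukowski_sum w (S n)) with (w * joukowski_sum w n + (/ w) ^ S n)%C.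
transitivity (w * ((w - / w) * joukowski_sum w n) + (w - / w) * (/ w) ^ S n)%C; [ring|].
rewrite IH. rewrite (Cpow_S w (S n)), (Cpow_S (/ w) (S n)). ring.
Qed.

Lemma joukowski_sum_rec w n : w <> RtoC 0 ->
  (joukowski_sum w (S (S n)) = (w + / w) * joukowski_sum w (S n) - joukowski_sum w n)%C.
Proof.
intros hw.
change (joukowski_sum w (S (S n))) with (w * joukowski_sum w (S n) + (/ w) ^ S (S n))%C.
rewrite (Cpow_S (/ w) (S n)).
transitivity (w * joukowski_sum w (S n) + / w * joukowski_sum w (S n)
  + (/ w * (/ w) ^ S n - / w * joukowski_sum w (S n)))%C; [ring|].
change (joukowski_sum w (S n)) with (w * joukowski_sum w n + (/ w) ^ S n)%C.
field. easy.
Qed.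

(** The monic Tchebychev polynomial of the second kind, 2^(-n) U_n; the
    scaling turns the recurrence U_(n+2) = 2 z U_(n+1) - U_n into the one
    below. *)
Fixpoint chebyshev (n : nat) (z : C) : C :=
  match n with
  | O => RtoC 1
  | S m => match m with
           | O => z
           | S k => (z * chebyshev m z - chebyshev k z / RtoC 4)%C
           end
  end.

Lemma chebyshev_joukowski w n : w <> RtoC 0 ->
  (RtoC 2 ^ n * chebyshev n ((w + / w) / RtoC 2) = joukowski_sum w n)%C.
Proof.
intros hw.
enough (H : (RtoC 2 ^ n * chebyshev n ((w + / w) / RtoC 2) = joukowski_sum w n)%C /\
  (RtoC 2 ^ S n * chebyshev (S n) ((w + / w) / RtoC 2) = joukowski_sum w (S n))%C) by apply H.
induction n as [|n [IH1 IH2]].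
- split; simpl; [ring|]. field. easy.
- split; [exact IH2|]. rewrite joukowski_sum_rec by easy. rewrite <- IH1, <- IH2.
  change (chebyshev (S (S n)) ((w + / w) / RtoC 2)) with
    ((w + / w) / RtoC 2 * chebyshev (S n) ((w + / w) / RtoC 2) - chebyshev n ((w + / w) / RtoC 2) / RtoC 4)%C.
  rewrite !Cpow_S. field. easy.
Qed.

Lemma monic_chebyshev n : monic n (chebyshev n).
Proof.
enough (H : monic n (chebyshev n) /\ monic (S n) (chebyshev (S n))) by apply H.
induction n as [|n [IH1 IH2]].
- split; exists (fun _ => RtoC 0); (split; [apply lowdeg_0|]); intros; simpl; ring.
- split; [easy|].
  assert (M : monic (S (S n)) (fun z => ((z - RtoC 0) * chebyshev (S n) z + (RtoC 0 + - (/ RtoC 4) * chebyshev n z))%C)).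
  { apply monic_plus_lowdeg; [now apply monic_mul_sub|].
    apply lowdeg_lin; [apply lowdeg_0|]. now apply lowdeg_S, monic_lowdeg. }
  destruct M as [G [h1 h2]]. exists G. split; [easy|]. intros z. rewrite <- h2.
  change (chebyshev (S (S n)) z) with (z * chebyshev (S n) z - chebyshev n z / RtoC 4)%C. unfold Cdiv. ring.
Qed.

Lemma de_moivre x n : ((cos x, sin x) ^ n)%C = (cos (INR n * x), sin (INR n * x)).
Proof.
induction n as [|n IH].
- simpl. rewrite Rmult_0_l, cos_0, sin_0. reflexivity.
- rewrite Cpow_S, IH, S_INR.
  replace ((INR n + 1) * x) with (x + INR n * x) by ring.
  rewrite cos_plus, sin_plus. apply C_eq; simpl; ring.
Qed.

Lemma Cinv_unit_circle x y : x * x + y * y = 1 -> (/ (x, y))%C = (x, - y).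
Proof.
intros h. assert (n : ((x, y) : C) <> RtoC 0).
{ intros e. inversion e; subst. lra. }
assert (e : ((x, y) * ((x, - y)%R : C))%C = RtoC 1) by (apply C_eq; simpl; lra).
transitivity (/ (x, y) * ((x, y) * ((x, - y)%R : C)))%C.
- rewrite e. ring.
- field. easy.
Qed.

(** At w = e^(i x) with x = k pi / (n + 1), both w^(n+1) and its inverse
    equal (-1)^k, while w differs from 1/w since 0 < x < pi. *)
Lemma chebyshev_node n k : (1 <= k <= n)%nat -> chebyshev n (node n k) = RtoC 0.
Proof.
intros hk. set (x := INR k * PI / INR (n + 1)).
pose proof (sin2_cos2 x) as e. unfold Rsqr in e.
set (w := (cos x, sin x) : C).
assert (ew : (/ w)%C = (cos (- x), sin (- x))).
{ unfold w. rewrite Cinv_unit_circle by lra. now rewrite cos_neg, sin_neg. }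
assert (hw : w <> RtoC 0).
{ intros h. pose proof (f_equal fst h) as h1. pose proof (f_equal snd h) as h2.
  simpl in h1, h2. rewrite h1, h2 in e. lra. }
assert (en : node n k = ((w + / w) / RtoC 2)%C).
{ unfold node. fold x. rewrite ew, cos_neg, sin_neg. unfold w.
  transitivity ((RtoC 2 * RtoC (cos x)) / RtoC 2)%C; [field|]. f_equal. apply C_eq; simpl; ring. }
pose proof (node_angle n k ltac:(lia)) as ha. fold x in ha.
assert (0 < INR (n + 1)) by (apply lt_0_INR; lia).
pose proof PI_RGT_0.
assert (hx : 0 < x).
{ unfold x. apply Rdiv_lt_0_compat; [|easy]. apply Rmult_lt_0_compat; [apply lt_0_INR; lia|lra]. }
assert (hs : 0 < sin x) by (apply sin_gt_0; lra).
pose proof (joukowski_sum_geometric w n hw) as G.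
rewrite <- (chebyshev_joukowski w n hw), <- en in G.
assert (Z : (w ^ S n - (/ w) ^ S n)%C = RtoC 0).
{ rewrite ew. unfold w. rewrite !de_moivre.
  replace (INR (S n) * - x) with (- (INR (S n) * x)) by ring.
  rewrite cos_neg, sin_neg.
  replace (INR (S n) * x) with (IZR (Z.of_nat k) * PI).
  - rewrite (sin_eq_0_1 (IZR (Z.of_nat k) * PI)) by now exists (Z.of_nat k).
    apply C_eq; simpl; ring.
  - rewrite <- INR_IZR_INZ. unfold x. replace (S n) with (n + 1)%nat by lia. field. lra. }
rewrite Z in G.
assert (n1 : (w - / w)%C <> RtoC 0).
{ rewrite ew, sin_neg, cos_neg. unfold w. intros h.
  apply (f_equal snd) in h. simpl in h. lra. }
assert (n2 : (RtoC 2 ^ n)%C <> RtoC 0).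
{ apply Cpow_nz. intros h. apply RtoC_inj in h. lra. }
revert G n1 n2. generalize (w - / w)%C (RtoC 2 ^ n)%C (chebyshev n (node n k)). clear.
intros a b x h ha hb. transitivity (/ a * / b * (a * (b * x)))%C; [now field|].
rewrite h. ring.
Qed.

(** Both polynomials are monic of degree n and vanish at the n nodes. *)
Lemma omega_chebyshev n z : omega n z = chebyshev n z.
Proof.
apply (monic_eq (nodes n)); try apply nodes_NoDup; rewrite ?nodes_length.
- apply monic_omega. - apply monic_chebyshev.
- intros a ha. apply in_nodes in ha. destruct ha as [k [hk ->]].
  now rewrite omega_node, chebyshev_node.
Qed.

Lemma omega_joukowski w n : w <> RtoC 0 ->
  2 ^ n * Cmod (omega n ((w + / w) / RtoC 2)%C) = Cmod (joukowski_sum w n).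
Proof.
intros hw. rewrite <- chebyshev_joukowski, omega_chebyshev, Cmod_mult, Cmod_pow, Cmod_R by easy.
f_equal. rewrite Rabs_right by lra. reflexivity.
Qed.

Lemma joukowski_sum_unit w n : Cmod w = 1 -> Cmod (joukowski_sum w n) <= INR (n + 1).
Proof.
intros hw. assert (h0 : w <> RtoC 0) by (apply Cmod_gt_0; lra).
induction n as [|n IH]; [simpl; rewrite Cmod_1; lra|].
change (joukowski_sum w (S n)) with (w * joukowski_sum w n + (/ w) ^ S n)%C.
eapply Rle_trans; [apply Cmod_triangle|].
rewrite Cmod_mult, Cmod_pow, Cmod_inv, hw, Rinv_1, pow1 by easy.
replace (S n + 1)%nat with (S (n + 1)) by lia. rewrite (S_INR (n + 1)). lra.
Qed.

(** On [-1, 1] write x = (w + 1/w)/2 with |w| = 1: each of the n + 1 terms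
    of the Joukowski sum has modulus 1. *)
Lemma omega_segment n x : -1 <= x <= 1 -> 2 ^ n * Cmod (omega n (RtoC x)) <= INR (n + 1).
Proof.
intros hx. assert (h : 0 <= 1 - x * x) by nra.
(* w = x + i sqrt (1 - x^2) lies on the unit circle and has real part x *)
pose proof (sqrt_def _ h) as e. set (y := sqrt (1 - x * x)) in *.
set (w := (x, y) : C).
assert (hw : Cmod w = 1).
{ unfold w, Cmod; simpl fst; simpl snd. transitivity (sqrt 1); [f_equal; lra|apply sqrt_1]. }
assert (h0 : w <> RtoC 0) by (apply Cmod_gt_0; lra).
assert (RtoC x = (w + / w) / RtoC 2)%C as ->.
{ unfold w. rewrite Cinv_unit_circle by lra.
  transitivity ((RtoC 2 * RtoC x) / RtoC 2)%C; [field|]. f_equal. apply C_eq; simpl; ring. }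
rewrite omega_joukowski by easy. now apply joukowski_sum_unit.
Qed.

(** On E_r, t = (w + 1/w)/2 with |w| = r, and the closed form of the
    Joukowski sum shows that it grows like r^n. *)
Lemma omega_ellipse n r t : 1 < r ->
  r ^ S n - 1 <= (r + / r) * (2 ^ n * Cmod (omega n (ellipse r t))).
Proof.
intros hr. unfold ellipse. cbv zeta. set (w := (r * cos t, r * sin t) : C).
assert (hw : Cmod w = r).
{ unfold w, Cmod; simpl fst; simpl snd. transitivity (sqrt (r * r)); [f_equal|apply sqrt_square; lra].
  pose proof (sin2_cos2 t) as e. unfold Rsqr in e.
  transitivity (r * r * (sin t * sin t + cos t * cos t)); [ring|]. rewrite e; ring. }
assert (h0 : w <> RtoC 0) by (apply Cmod_gt_0; lra).
rewrite omega_joukowski by easy.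
pose proof (f_equal Cmod (joukowski_sum_geometric w n h0)) as G. rewrite Cmod_mult in G.
assert (h1 : Cmod (w - / w) <= r + / r).
{ eapply Rle_trans; [apply Cmod_triangle|]. rewrite Cmod_opp, Cmod_inv, hw by easy. lra. }
assert (h2 : r ^ S n <= Cmod (w ^ S n - (/ w) ^ S n) + 1).
{ rewrite <- hw at 1. rewrite <- Cmod_pow.
  replace (w ^ S n)%C with ((w ^ S n - (/ w) ^ S n) + (/ w) ^ S n)%C at 1 by ring.
  eapply Rle_trans; [apply Cmod_triangle|]. apply Rplus_le_compat_l.
  rewrite Cmod_pow, Cmod_inv, hw by easy.
  assert (0 < / r) by (apply Rinv_0_lt_compat; lra).
  assert (/ r <= 1) by (rewrite <- Rinv_1; apply Rinv_le_contravar; lra).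
  rewrite <- (pow1 (S n)). apply pow_incr. lra. }
pose proof (Cmod_ge_0 (joukowski_sum w n)). nra.
Qed.

(** The first three terms of the binomial expansion: a quadratic lower bound
    is enough to beat the factor n + 1 of [omega_segment]. *)
Lemma pow_quadratic_lower h m : 0 <= h -> 1 + INR m * h + INR m * (INR m - 1) / 2 * (h * h) <= (1 + h) ^ m.
Proof.
intros hh. induction m as [|m IH]; [simpl; lra|].
rewrite S_INR. simpl pow.
pose proof (pos_INR m) as hm.
assert (0 <= INR m * (INR m - 1)).
{ destruct m; [simpl; lra|]. rewrite S_INR in *. pose proof (pos_INR m). nra. }
assert (0 <= INR m * (INR m - 1) * (h * h * h)).
{ apply Rmult_le_pos; [easy|]. repeat apply Rmult_le_pos; easy. }
apply Rle_trans with ((1 + h) * (1 + INR m * h + INR m * (INR m - 1) / 2 * (h * h))); [|nra].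
nra.
Qed.

Lemma omega_ratio n r x t : (1 <= n)%nat -> 1 < r -> -1 <= x <= 1 ->
  Cmod (omega n (RtoC x)) * / Cmod (omega n (ellipse r t))
   <= 2 * (r + / r) / ((r - 1) * (r - 1)) / INR n.
Proof.
intros hn hr hx. set (h := r - 1).
pose proof (omega_segment n x hx) as h1. pose proof (omega_ellipse n r t hr) as h2.
assert (N1 : 1 <= INR n) by (change 1 with (INR 1); apply le_INR; lia).
pose proof (pow_quadratic_lower h (S n) ltac:(unfold h; lra)) as h3.
replace (1 + h) with r in h3 by (unfold h; ring).
rewrite plus_INR in h1. change (INR 1) with 1 in h1. rewrite S_INR in h3.
assert (hh : 0 < h * h) by (unfold h; nra).
assert (hri : 0 < / r) by (apply Rinv_0_lt_compat; lra).
assert (p2 : 0 < 2 ^ n) by (apply pow_lt; lra).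
set (A := Cmod (omega n (RtoC x))) in *. set (B := Cmod (omega n (ellipse r t))) in *.
set (c := r + / r) in *. assert (hc : 0 < c) by (unfold c; lra).
assert (h4 : (INR n + 1) * INR n * (h * h) / 2 <= c * (2 ^ n * B)).
{ assert (0 <= (INR n + 1) * h) by (unfold h; nra). lra. }
assert (hB : 0 < B).
{ assert (0 < c * 2 ^ n * B). 2:{ assert (0 < c * 2 ^ n) by (now apply Rmult_lt_0_compat). nra. }
  apply Rlt_le_trans with ((INR n + 1) * INR n * (h * h) / 2); [|lra].
  assert (0 < (INR n + 1) * INR n) by nra. nra. }
assert (hne : h <> 0) by (unfold h; lra).
apply Rmult_le_reg_r with (B * (INR n * (h * h))).
{ apply Rmult_lt_0_compat; [easy|]. apply Rmult_lt_0_compat; lra. }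
replace (A * / B * (B * (INR n * (h * h)))) with (A * (INR n * (h * h))) by (field; lra).
replace (2 * c / (h * h) / INR n * (B * (INR n * (h * h)))) with (2 * c * B)
  by (field; repeat split; lra).
apply Rmult_le_reg_l with (2 ^ n); [easy|].
assert (2 ^ n * A * (INR n * (h * h)) <= (INR n + 1) * (INR n * (h * h))).
{ apply Rmult_le_compat_r; [|lra]. apply Rmult_le_pos; lra. }
lra.
Qed.

(** * The interpolating polynomial and its error *)

Lemma curve_cont_Csum (F : nat -> R -> C) a b t :
  (forall k, (a <= k <= b)%nat -> curve_cont (F k) t) ->
  curve_cont (fun u => Csum (fun k => F k u) a b) t.
Proof.
intros h. destruct (le_lt_dec a b) as [hab|hab].
- induction hab as [|b hab IH].
  + apply (curve_cont_ext (F a)); [|apply h; lia]. intros u. now rewrite sum_n_n.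
  + apply (curve_cont_ext (fun u => (Csum (fun k => F k u) a b + F (S b) u)%C)).
    * intros u. now rewrite sum_n_Sm by lia.
    * apply curve_cont_plus; [apply IH; intros; apply h; lia|apply h; lia].
- apply (curve_cont_ext (fun _ => RtoC 0)); [|apply curve_cont_const].
  intros u. now rewrite sum_n_m_zero.
Qed.

Lemma CInt_Csum (F : nat -> R -> C) a b s t : (a <= b)%nat ->
  (forall k u, (a <= k <= b)%nat -> curve_cont (F k) u) ->
  CInt (fun u => Csum (fun k => F k u) a b) s t = Csum (fun k => CInt (F k) s t) a b.
Proof.
intros hab h. induction hab as [|b hab IH].
- rewrite sum_n_n. apply (RInt_ext (V := C_R_CompleteNormedModule)). intros u _.
  exact (sum_n_n (G := C_AbelianMonoid) (fun k => F k u) a).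
- rewrite sum_n_Sm by lia. rewrite <- IH by (intros; apply h; lia).
  change (CInt (fun u => Csum (fun k => F k u) a (S b)) s t =
    (CInt (fun u => Csum (fun k => F k u) a b) s t + CInt (F (S b)) s t)%C).
  rewrite <- CInt_plus.
  + apply (RInt_ext (V := C_R_CompleteNormedModule)). intros u _.
    exact (sum_n_Sm (G := C_AbelianMonoid) (fun k => F k u) a b ltac:(lia)).
  + intros; apply curve_cont_Csum; intros; apply h; lia.
  + intros; apply h; lia.
Qed.

Lemma two_pi_i_neq0 : (RtoC 2 * RtoC PI * Ci)%C <> RtoC 0.
Proof.
pose proof PI_RGT_0. repeat apply Cmult_neq_0; try apply Ci_nz;
intros h; apply RtoC_inj in h; lra.
Qed.

Lemma segment_interior r x : 1 < r -> -1 <= x <= 1 -> ellipse_interior r (RtoC x).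
Proof.
intros hr hx. destruct (semi_pos r hr) as [ha hb]. unfold ellipse_interior; simpl fst; simpl snd.
assert (0 < semi_b r ^ 2) by (apply pow_lt; lra).
assert (x ^ 2 < semi_a r ^ 2) by nra. nra.
Qed.

Lemma node_interior r n k : 1 < r -> ellipse_interior r (node n k).
Proof. intros hr. apply segment_interior; [easy|]. apply COS_bound. Qed.

Section Interpolation.
Variables (r : R) (f : C -> C).
Hypothesis hr : 1 < r.
Hypothesis hf : forall w, ellipse_form r w <= semi_a r ^ 2 * semi_b r ^ 2 -> holomorphic_at f w.

Let E := ellipse r.
Let T := ellipse_tangent r.

Lemma ellipse_on_boundary t : ellipse_form r (E t) <= semi_a r ^ 2 * semi_b r ^ 2.
Proof.
unfold E, ellipse_form. rewrite ellipseE by lra. simpl fst; simpl snd.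
pose proof (sin2_cos2 t) as e. unfold Rsqr in e. right.
transitivity (semi_a r ^ 2 * semi_b r ^ 2 * (sin t * sin t + cos t * cos t)); [ring|].
rewrite e; ring.
Qed.

Lemma curve_cont_ellipse t : curve_cont E t.
Proof.
apply (curve_cont_ext (fun t => (semi_a r * cos t, semi_b r * sin t))).
- intros u. unfold E. now rewrite ellipseE by lra.
- split; simpl; apply (ex_derive_continuous (V := R_NormedModule)); auto_derive; auto.
Qed.

Lemma curve_cont_tangent t : curve_cont T t.
Proof.
split; unfold T, ellipse_tangent; simpl;
apply (ex_derive_continuous (V := R_NormedModule)); auto_derive; auto.
Qed.

Lemma curve_cont_cauchy z t : ellipse_interior r z ->
  curve_cont (fun t => (f (E t) * / (E t - z) * T t)%C) t.
Proof.
intros hz. apply curve_cont_mult; [|apply curve_cont_tangent].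
apply (curve_cont_holo (fun w => (f w * / (w - z))%C) E); [apply curve_cont_ellipse|].
apply holo_mult; [apply hf, ellipse_on_boundary|].
apply holo_inv_sub. now apply ellipse_neq_interior.
Qed.

Let integrand n z t : C :=
  ((omega n (E t) - omega n z) / (E t - z) * (f (E t) / omega n (E t)) * T t)%C.

Lemma integrand_partial_fractions n z t : (1 <= n)%nat -> ellipse_interior r z ->
  integrand n z t = Csum (fun k => (omega_quot n k z / C_derive (omega n) (node n k) *
    (f (E t) * / (E t - node n k) * T t))%C) 1 n.
Proof.
intros hn hz. unfold integrand.
transitivity ((f (E t) * T t) * ((omega n (E t) - omega n z) / (E t - z) / omega n (E t)))%C.
{ unfold Cdiv. ring. }
rewrite kernel_partial_fractions; auto.
- rewrite <- Csum_scal. apply sum_n_m_ext. intros k. to_C. ring.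
- now apply ellipse_neq_interior.
- intros k hk. apply ellipse_neq_interior; auto using node_interior.
Qed.

Lemma interp_poly_integrand n z :
  interp_poly r f n z = (/ (RtoC 2 * RtoC PI * Ci) * CInt (integrand n z) 0 (2 * PI))%C.
Proof.
unfold interp_poly, contour_integral. f_equal.
apply (RInt_ext (V := C_R_CompleteNormedModule)). intros t _.
unfold integrand, E, T. now rewrite path_derive_ellipse.
Qed.

Lemma interp_poly_lagrange n z : (1 <= n)%nat -> ellipse_interior r z ->
  interp_poly r f n z = Csum (fun k => (omega_quot n k z *
    (f (node n k) / C_derive (omega n) (node n k)))%C) 1 n.
Proof.
intros hn hz. rewrite interp_poly_integrand.
rewrite (RInt_ext (V := C_R_CompleteNormedModule) _ _ _ _
  (fun t _ => integrand_partial_fractions n z t hn hz)).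
rewrite CInt_Csum; [|easy|].
2:{ intros k u hk. apply curve_cont_mult; [apply curve_cont_const|].
    apply curve_cont_cauchy. now apply node_interior. }
rewrite <- Csum_scal. apply sum_n_m_ext. intros k.
rewrite CInt_scal by (intros; apply curve_cont_cauchy; now apply node_interior).
unfold E, T. rewrite cauchy_ellipse by auto using node_interior.
pose proof two_pi_i_neq0 as h. revert h. unfold Cdiv.
generalize (RtoC 2 * RtoC PI * Ci)%C (/ C_derive (omega n) (node n k))%C. intros c d hc.
to_C. field. exact hc.
Qed.

Lemma interp_poly_node n k : (1 <= k <= n)%nat ->
  interp_poly r f n (node n k) = f (node n k).
Proof.
intros hk. rewrite interp_poly_lagrange by (lia || now apply node_interior).
rewrite (Csum_single _ k) by (auto; intros j hj hjk; rewrite omega_quot_other by auto; to_C; ring).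
rewrite C_derive_omega_node by easy. to_C. field. now apply omega_quot_self.
Qed.

Lemma cauchy_density_bounded z : ellipse_interior r z ->
  exists M, 0 < M /\ forall t, 0 <= t <= 2 * PI -> Cmod (f (E t) * / (E t - z) * T t)%C <= M.
Proof.
intros hz.
destruct (bounded_continuity (V := C_R_NormedModule)
  (fun t => (f (E t) * / (E t - z) * T t)%C) 0 (2 * PI)) as [M hM].
- intros t _. apply curve_cont_continuous. now apply curve_cont_cauchy.
- exists (Rmax M 1). split; [eapply Rlt_le_trans; [apply Rlt_0_1|apply Rmax_r]|].
  intros t ht. eapply Rle_trans; [|apply Rmax_l]. rewrite Cmod_norm. apply Rlt_le, hM, ht.
Qed.

(** Subtracting the integral for L_(n-1) from Cauchy's formula leaves
    omega_n(x) / omega_n(t) * f(t) / (t - x) as integrand. *)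
Lemma interp_error n x M : (1 <= n)%nat -> -1 <= x <= 1 ->
  (forall t, 0 <= t <= 2 * PI -> Cmod (f (E t) * / (E t - RtoC x) * T t)%C <= M) ->
  Cmod (f (RtoC x) - interp_poly r f n (RtoC x))%C
    <= 2 * (r + / r) / ((r - 1) * (r - 1)) / INR n * M.
Proof.
intros hn hx hM. assert (hi := segment_interior r x hr hx).
pose proof PI_RGT_0 as hpi.
assert (c1 : forall t, curve_cont (integrand n (RtoC x)) t).
{ intros t. apply (curve_cont_ext (fun t => Csum (fun k => (omega_quot n k (RtoC x) / C_derive (omega n) (node n k) *
    (f (E t) * / (E t - node n k) * T t))%C) 1 n)).
  - intros u. now rewrite integrand_partial_fractions.
  - apply curve_cont_Csum. intros k hk. apply curve_cont_mult; [apply curve_cont_const|].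
    apply curve_cont_cauchy. now apply node_interior. }
assert (c2 : forall t, curve_cont (fun t => (- RtoC 1 * integrand n (RtoC x) t)%C) t).
{ intros t. apply curve_cont_mult; [apply curve_cont_const|apply c1]. }
assert (Ef : (f (RtoC x) - interp_poly r f n (RtoC x))%C =
  (/ (RtoC 2 * RtoC PI * Ci) * CInt (fun t => (f (E t) * / (E t - RtoC x) * T t
     + - RtoC 1 * integrand n (RtoC x) t)%C) 0 (2 * PI))%C).
{ rewrite CInt_plus by (intros; auto using curve_cont_cauchy).
  rewrite CInt_scal by auto.
  unfold E, T at 1. rewrite cauchy_ellipse by auto. rewrite interp_poly_integrand.
  pose proof two_pi_i_neq0 as h. revert h.
  generalize (RtoC 2 * RtoC PI * Ci)%C. intros c hc. field. exact hc. }
rewrite Ef, Cmod_mult, Cmod_inv by apply two_pi_i_neq0.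
rewrite !Cmod_mult, Cmod_Ci, !Cmod_R, !Rabs_right by lra.
set (B := 2 * (r + / r) / ((r - 1) * (r - 1)) / INR n).
assert (hI : Cmod (CInt (fun t => (f (E t) * / (E t - RtoC x) * T t
     + - RtoC 1 * integrand n (RtoC x) t)%C) 0 (2 * PI)) <= (2 * PI - 0) * (B * M)).
{ apply CInt_bound; [lra| |].
  - intros; apply curve_cont_plus; auto using curve_cont_cauchy.
  - intros t ht. 
    assert (n1 : (E t - RtoC x)%C <> RtoC 0).
    { apply Cminus_eq_contra. now apply ellipse_neq_interior. }
    assert (n2 : omega n (E t) <> RtoC 0).
    { apply Cprod_neq0. intros k _. apply Cminus_eq_contra.
      apply ellipse_neq_interior; auto using node_interior. }
    replace (f (E t) * / (E t - RtoC x) * T t + - RtoC 1 * integrand n (RtoC x) t)%C with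
     (omega n (RtoC x) * / omega n (E t) * (f (E t) * / (E t - RtoC x) * T t))%C
     by (unfold integrand; field; auto).
    rewrite Cmod_mult. apply Rmult_le_compat; try apply Cmod_ge_0; [|auto].
    rewrite Cmod_mult, Cmod_inv by easy. now apply omega_ratio. }
apply Rle_trans with (/ (2 * PI * 1) * ((2 * PI - 0) * (B * M))).
- apply Rmult_le_compat_l; [|exact hI]. apply Rlt_le, Rinv_0_lt_compat; lra.
- right. field. lra.
Qed.

Lemma interp_poly_converges x : -1 <= x <= 1 ->
  filterlim (fun n : nat => (f (RtoC x) - interp_poly r f n (RtoC x))%C)
       eventually (locally (RtoC 0)).
Proof.
intros hx. destruct (cauchy_density_bounded (RtoC x) (segment_interior r x hr hx)) as [M [M0 hM]].
apply filterlim_locally. intros eps.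
set (K := 2 * (r + / r) / ((r - 1) * (r - 1))).
destruct (INR_unbounded (K * M / eps)) as [N hN].
exists (S N). intros n hn.
pose proof (interp_error n x M ltac:(lia) hx hM) as e. fold K in e.
assert (hn0 : 0 < INR n) by (apply lt_0_INR; lia).
assert (hlt : Cmod (f (RtoC x) - interp_poly r f n (RtoC x))%C < eps).
{ eapply Rle_lt_trans; [exact e|].
  assert (K * M / eps < INR n).
  { eapply Rlt_le_trans; [exact hN|]. apply le_INR. lia. }
  pose proof (cond_pos eps).
  apply Rmult_lt_reg_r with (INR n); [easy|].
  replace (K / INR n * M * INR n) with (K * M / eps * eps) by (field; lra).
  rewrite (Rmult_comm eps). now apply Rmult_lt_compat_r. }
set (d := (f (RtoC x) - interp_poly r f n (RtoC x))%C) in *.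
split.
- change (Rabs (fst d - 0) < eps). rewrite Rminus_0_r.
  eapply Rle_lt_trans; [apply fst_le_Cmod|exact hlt].
- change (Rabs (snd d - 0) < eps). rewrite Rminus_0_r.
  eapply Rle_lt_trans; [apply snd_le_Cmod|exact hlt].
Qed.
End Interpolation.

Theorem proposition12 (r : R) (f : C -> C) (hr : 1 < r)
  (hf : analytic_near (Cclosure (ellipse_interior r)) f) :
  (forall (n : nat), (1 <= n)%nat ->
    (forall z : C, ellipse_interior r z ->
       interp_poly r f n z =
       sum_n_m (G := C_AbelianMonoid)
         (fun k => (omega_quot n k z *
                    (f (node n k) / C_derive (omega n) (node n k)))%C) 1 n)
    /\
    (forall k : nat, (1 <= k <= n)%nat ->
       (f (node n k) - interp_poly r f n (node n k))%C = RtoC 0))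
  /\
  (forall x : R, -1 <= x <= 1 ->
     filterlim (fun n : nat => (f (RtoC x) - interp_poly r f n (RtoC x))%C)
       eventually (locally (RtoC 0))).
Proof.
assert (hol : forall w, ellipse_form r w <= semi_a r ^ 2 * semi_b r ^ 2 -> holomorphic_at f w)
  by (intros; now apply (analytic_near_holomorphic r)).
split; [|now apply interp_poly_converges].
intros n hn. split.
- intros z hz. now apply interp_poly_lagrange.
- intros k hk. rewrite interp_poly_node by auto. ring.
Qed.
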